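(* For every $\delta>0$ there exist constants $c>0$ and $C>0$ such that, for $G=G(n,p)$ with $p=p(n)$, the following hold with high probability (i.e. with probability tending to $1$ as $n\to\infty$): (i) if $p\le c\,n^{-1/2}$, then $\mathrm{Gallai}(G)\ge 3^{(1-\delta)e(G)}$; (ii) if $p\ge C\,n^{-1/2}$, then $\mathrm{Gallai}(G)\le 2^{(1+\delta)e(G)}$.
   Context: $G(n,p)$ denotes the Erdős–Rényi random graph on $n$ vertices in which each pair of vertices is an edge independently with probability $p$. For a graph $G$, $e(G)=|E(G)|$. A Gallai $3$-colouring of a graph $G$ is a colouring of $E(G)$ with colours $\{1,2,3\}$ containing no rainbow triangle, i.e. no triangle whose three edges receive three distinct colours. $\mathrm{Gallai}(G)$ denotes the number of Gallai $3$-colourings of $G$. *)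

(* Defs.v *)
From HB Require Import structures.
From mathcomp Require Import all_boot all_order all_algebra.
From mathcomp Require Import all_classical all_reals all_analysis.

Set Implicit Arguments.
Unset Strict Implicit.
Unset Printing Implicit Defensive.

Import Order.TTheory GRing.Theory Num.Theory.
Import numFieldNormedType.Exports.

Local Open Scope ring_scope.

Definition vpairs (n : nat) : {set {set 'I_n}} :=
  [set e : {set 'I_n} | #|e| == 2].

Record sgraph (n : nat) := SGraph {
  edges : {set {set 'I_n}};
  edges_vpairs : edges \subset vpairs n }.

HB.instance Definition _ n := [isSub for @edges n].
HB.instance Definition _ n := [Finite of sgraph n by <:].

Definition edge_count n (G : sgraph n) : nat := #|edges G|.

Definition edge n (G : sgraph n) := {e : {set 'I_n} | e \in edges G}.

Definition triangle n (G : sgraph n) (e f g : edge G) : bool :=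
  [exists x : 'I_n, exists y : 'I_n, exists z : 'I_n,
    [&& uniq [:: x; y; z], val e == [set x; y], val f == [set y; z]
      & val g == [set x; z]]].

Definition gallai_colouring n (G : sgraph n) (phi : {ffun edge G -> 'I_3}) :
    bool :=
  ~~ [exists e : edge G, exists f : edge G, exists g : edge G,
        triangle e f g && uniq [:: phi e; phi f; phi g]].

Definition Gallai n (G : sgraph n) : nat :=
  #|[set phi : {ffun edge G -> 'I_3} | gallai_colouring phi]|.

(* The sample space of G(n,p) is the type of all graphs on 'I_n; the weight of a
   graph is its probability when every pair of vertices is an edge
   independently with probability p. *)
Section RandomGraph.
Variable R : realType.

Definition gnp_weight n (p : R) (G : sgraph n) : R :=
  \prod_(e in vpairs n) (if e \in edges G then p else 1 - p).

Definition gnp_prob n (p : R) (A : pred (sgraph n)) : R :=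
  \sum_(G : sgraph n | A G) gnp_weight p G.

Lemma gnp_probT n (p : R) : gnp_prob p (fun _ : sgraph n => true) = 1.
Proof.
transitivity (\prod_(e : {set 'I_n})
    ((if e \in vpairs n then p else 0) + (if e \in vpairs n then 1 - p else 1))).
  rewrite bigA_distr [RHS](bigID (fun E : {set {set 'I_n}} => E \subset vpairs n)) /=.
  rewrite [X in _ = _ + X]big1 ?addr0; last first.
    move=> E /subsetPn[e eE eV].
    by rewrite (bigD1 e) //= eE (negbTE eV) mul0r.
  rewrite [RHS](reindex_omap (@edges n) insub) /=; last first.
    by move=> E EV; rewrite insubT.
  apply: eq_big => [G|G _]; first by rewrite (valK G) eqxx edges_vpairs.
  rewrite /gnp_weight big_mkcond; apply: eq_bigr => e _.
  case: ifPn => // eV; case: ifPn => // eG.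
  by rewrite (fintype.subsetP (edges_vpairs G)) in eV.
by apply: big1 => e _; case: ifP; rewrite ?add0r // addrCA subrr addr0.
Qed.

Local Open Scope classical_set_scope.

Definition whp (p : nat -> R) (A : forall n, pred (sgraph n)) : Prop :=
  (fun n => gnp_prob (p n) (A n)) @ \oo --> (1 : R).

End RandomGraph.

(* Main.v *)
Require Import Defs.
From mathcomp Require Import all_boot all_order all_algebra.
From mathcomp Require Import all_classical all_reals all_analysis.
From mathcomp Require Import ring lra.

(* Lower bound: giving one colour to all edges that lie in a triangle and
   colouring the other edges arbitrarily is a Gallai colouring, and for small
   [c] the number of triangles is a small fraction of the number of edges.

   Upper bound: split the vertices into [k] blocks and take a uniformly random
   Gallai colouring. Conditioning on the colours of the edges touching a block
   never decreases the energy (the mean squared conditional probabilities of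
   the colours of the edges), so there is a set [S] of few edges such that,
   after conditioning on [S], adding any further block gains little energy.
   Then the three colours on a typical triangle are nearly independent given
   [S]. As a rainbow triangle is impossible, the palettes [A], [B], [C] of the
   colours of non-negligible conditional probability have no rainbow
   transversal, so [#|A| * #|B| * #|C| <= 8]. For [p >= C n^(-1/2)] almost all
   edges have about the same, large, number of common neighbours in every
   block, so averaging over the triangles gives
   [\sum_e ln #|A_e| <= (1 + o(1)) e(G) ln 2], and Gibbs' inequality bounds
   the number of colourings.

   Both concentration statements follow from the Efron-Stein inequality. *)

Set Implicit Arguments.
Unset Strict Implicit.
Unset Printing Implicit Defensive.

Import Order.TTheory GRing.Theory Num.Theory.
Import numFieldNormedType.Exports.

Local Open Scope ring_scope.

(** * Conditional colour probabilities in a family of colourings *)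

Section Colourings.
Variables (R : realType) (E : finType).
Local Notation col := {ffun E -> 'I_3}.
Implicit Types (S : {set E}) (phi psi : col) (e f g : E) (a b c : 'I_3).

Definition agree S phi psi := [forall e in S, phi e == psi e].

Lemma agreeP S phi psi :
  reflect (forall e, e \in S -> phi e = psi e) (agree S phi psi).
Proof. by apply: (iffP forall_inP) => H e eS; apply/eqP/H. Qed.

Lemma agreexx S phi : agree S phi phi.
Proof. exact/agreeP. Qed.

Lemma agreeC S phi psi : agree S phi psi = agree S psi phi.
Proof. by apply: eq_forallb => e; rewrite eq_sym. Qed.

Lemma agree_trans S : transitive (agree S).
Proof.
move=> psi phi chi /agreeP H1 /agreeP H2; apply/agreeP => e eS.
by rewrite H1// H2.
Qed.

Lemma agreeS S S' phi psi : S \subset S' -> agree S' phi psi -> agree S phi psi.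
Proof. by move=> /fintype.subsetP SS' /agreeP H; apply/agreeP => e /SS'/H. Qed.

(** Measurability for the partition of the colourings by their restriction to [S]; the classes are
    the atoms to condition on. *)
Definition measurable_on S T (h : col -> T) :=
  forall phi psi, agree S phi psi -> h phi = h psi.

(** On each class of colourings agreeing on [S], the weights [rho] are fixed and their product is a
    subprobability. There are [3 ^ #|S|] classes, so the products sum to at most [3 ^+ #|S|] over
    [F]; comparing with the uniform law on [F] is Gibbs' inequality. *)
Lemma gibbs_count (F : {set col}) S (rho : col -> E -> 'I_3 -> R) :
    (0 < #|F|)%N ->
    measurable_on S rho ->
    (forall phi e c, 0 < rho phi e c) ->
    (forall phi e, \sum_c rho phi e c <= 1) ->
  ln (#|F|%:R : R) <= #|S|%:R * ln 3 +
    #|F|%:R^-1 * \sum_(phi in F) \sum_e - ln (rho phi e (phi e)).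
Proof.
move=> F0 mrho rho0 rho1.
have N0 : 0 < #|F|%:R :> R by rewrite ltr0n.
pose P phi := \prod_e rho phi e (phi e).
have P0 phi : 0 < P phi by apply: prodr_gt0.
have PS : \sum_(phi in F) P phi <= 3 ^+ #|S|.
  (* [res phi] is a canonical representative of the class of [phi]: the colours off [S] are reset to
     [ord0]. *)
  pose res phi : col := [ffun e => if e \in S then phi e else ord0].
  have resE phi : rho phi = rho (res phi).
    by apply: mrho; apply/agreeP => e eS; rewrite ffunE eS.
  rewrite (partition_big res [in pffun_on ord0 (mem S) predT]) /=; last first.
    move=> phi _; apply/pffun_onP; split; last by move=> ? _; rewrite inE.
    apply/fintype.subsetP => e; rewrite inE ffunE.
    by case: (boolP (e \in S)) => //=; rewrite eqxx.
  have -> : (3 : R) ^+ #|S| = \sum_(psi in pffun_on (ord0 : 'I_3) (mem S) predT) 1.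
    rewrite sumr_const card_pffun_on -natrX; congr (_%:R).
    by congr (_ ^ _)%N; rewrite -[LHS]card_ord; apply: eq_card.
  apply: ler_sum => psi _.
  apply: (@le_trans _ _ (\sum_(phi : col) \prod_e rho psi e (phi e))).
    rewrite big_mkcond /=; apply: ler_sum => phi _.
    case: ifP => [/andP[_ /eqP <-]|_]; first by rewrite /P (resE phi).
    by apply: prodr_ge0 => e _; apply: ltW.
  rewrite -(bigA_distr_bigA (fun e c => rho psi e c)).
  rewrite [leRHS](_ : _ = \prod_(e : E) 1); last by rewrite big1_eq.
  apply: ler_prod => e _; rewrite rho1 andbT.
  by apply: sumr_ge0 => c _; apply: ltW.
have lnP phi : \sum_e - ln (rho phi e (phi e)) = - ln (P phi).
  suff [] : ln (P phi) = \sum_e ln (rho phi e (phi e)) /\ 0 < P phi.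
    by move=> -> _; rewrite sumrN.
  rewrite /P; elim/big_rec2: _ => [|e x y _ [<- x0]]; first by rewrite ln1.
  by rewrite lnM ?posrE// mulr_gt0.
have K0 : 0 < (3 : R) ^+ #|S| by apply: exprn_gt0.
(* This is [ln x <= x - 1] at [x = #|F| * P phi / 3 ^ #|S|]. By [PS], the values of [x - 1] sum to
   at most 0 over [F]. *)
have H phi : ln #|F|%:R <= #|S|%:R * ln 3 - ln (P phi)
                + (#|F|%:R * P phi / 3 ^+ #|S| - 1).
  have X0 : 0 < #|F|%:R * P phi / 3 ^+ #|S| by rewrite divr_gt0// mulr_gt0.
  have /le_ln1Dx : -1 < #|F|%:R * P phi / 3 ^+ #|S| - 1 by lra.
  rewrite [1 + _]addrC subrK.
  rewrite ln_div ?posrE ?mulr_gt0// lnM ?posrE// lnXn// -mulr_natl.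
  lra.
have {}H : \sum_(phi in F) ln #|F|%:R <= \sum_(phi in F) (#|S|%:R * ln 3 - ln (P phi)
                + (#|F|%:R * P phi / 3 ^+ #|S| - 1)).
  by apply: ler_sum => phi _; exact: H.
rewrite -(ler_pM2l N0) mulrDr mulVKf ?gt_eqF//.
move: H; rewrite !big_split/= !sumr_const -[ln _ *+ _]mulr_natl.
rewrite -[(_ * ln 3) *+ _]mulr_natl -[(-1) *+ _]mulr_natl => H.
apply: (le_trans H).
under [X in _ <= _ + X]eq_bigr do rewrite lnP.
rewrite -addrA lerD2l -[leRHS]addr0 lerD2l.
rewrite mulrN1 subr_le0 -mulr_suml -mulr_sumr ler_pdivrMr// ler_pM2l//.
Qed.

Variable F : {set col}.

Definition agree_class S phi := [set psi in F | agree S phi psi].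

(* The conditional probability that a uniform element of [F] gives [e] the
   colour [c], given that it agrees with [phi] on [S]. *)
Definition condp S phi e c : R :=
  #|[set psi in agree_class S phi | psi e == c]|%:R / #|agree_class S phi|%:R.

Lemma agree_class_eq S phi psi :
  agree S phi psi -> agree_class S phi = agree_class S psi.
Proof.
move=> H; apply/setP => chi; rewrite !inE; congr (_ && _).
apply/idP/idP; last exact: agree_trans.
by apply: agree_trans; rewrite agreeC.
Qed.

Lemma condp_measurable S : measurable_on S (condp S).
Proof.
by move=> phi psi H; apply/funext => e; apply/funext => c;
  rewrite /condp (agree_class_eq H).
Qed.

Lemma agree_class_gt0 S phi : phi \in F -> (0 < #|agree_class S phi|)%N.
Proof. by move=> phiF; apply/card_gt0P; exists phi; rewrite inE phiF agreexx. Qed.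

Lemma condp_ge0 S phi e c : 0 <= condp S phi e c.
Proof. by rewrite divr_ge0. Qed.

Lemma condpE S phi e c : condp S phi e c =
  \sum_(psi in F | agree S phi psi) (psi e == c)%:R / #|agree_class S phi|%:R.
Proof.
rewrite -mulr_suml -natr_sum -big_mkcondr sum1_card /condp.
by congr (_%:R / _); apply: eq_card => psi; rewrite !inE.
Qed.

Lemma sum_condp S phi e : phi \in F -> \sum_c condp S phi e c = 1.
Proof.
move=> phiF; under eq_bigr do rewrite condpE.
rewrite exchange_big /=.
under eq_bigr => psi _.
  rewrite -mulr_suml -natr_sum (bigD1 (psi e))//= eqxx big1 ?addn0; last first.
    by move=> c /negPf; rewrite eq_sym => ->.
  over.
rewrite sumr_const (_ : #|_| = #|agree_class S phi|); last first.
  by apply: eq_card => psi; rewrite !inE.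
by rewrite -[_ *+ #|_|]mulr_natr divfK// pnatr_eq0 -lt0n agree_class_gt0.
Qed.

Lemma condp_le1 S phi e c : phi \in F -> condp S phi e c <= 1.
Proof.
move=> phiF; rewrite -(sum_condp S e phiF) (bigD1 c)//= lerDl.
by apply: sumr_ge0 => *; apply: condp_ge0.
Qed.

(** [condp S] is a conditional expectation, and [h] is constant on the classes. Exchanging the sums
    over a colouring and over its class leaves, for each [psi], as many equal terms as its class has
    elements. *)
Lemma condp_tower S e c (h : col -> R) : measurable_on S h ->
  \sum_(phi in F) h phi * condp S phi e c =
  \sum_(phi in F) h phi * (phi e == c)%:R.
Proof.
move=> mh; under eq_bigr do rewrite condpE big_distrr /=.
rewrite (exchange_big_dep (mem F)) /=; last by move=> ? ? _ /andP[].
apply: eq_bigr => psi psiF.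
transitivity (\sum_(phi in F | agree S psi phi)
    h psi * (psi e == c)%:R / #|agree_class S psi|%:R).
  apply: eq_big => [phi|phi]; first by rewrite psiF agreeC.
  by move=> /andP[_ /andP[_ A]]; rewrite (mh _ _ A) (agree_class_eq A) mulrA.
rewrite sumr_const (_ : #|_| = #|agree_class S psi|); last first.
  by apply: eq_card => phi; rewrite !inE.
by rewrite -[_ *+ #|_|]mulr_natr divfK// pnatr_eq0 -lt0n agree_class_gt0.
Qed.

(** Not normalised: this is [#|F|] times the mean energy, and so ranges up to [#|F|]. *)
Definition energy S e : R := \sum_(phi in F) \sum_c condp S phi e c ^+ 2.

Definition gain S S' e : R :=
  \sum_(phi in F) \sum_c (condp S' phi e c - condp S phi e c) ^+ 2.

(** Pythagoras for conditional expectations: by the tower property the increment from [S] to [S'] is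
    orthogonal to [condp S]. *)
Lemma gainE S S' e : S \subset S' -> gain S S' e = energy S' e - energy S e.
Proof.
move=> SS'; rewrite /gain /energy -sumrB exchange_big /=.
under [RHS]eq_bigr do rewrite -sumrB.
rewrite [RHS]exchange_big /=; apply: eq_bigr => c _.
have cross : \sum_(phi in F) condp S phi e c * condp S' phi e c =
             \sum_(phi in F) condp S phi e c * condp S phi e c.
  have mS : measurable_on S (fun phi => condp S phi e c).
    by move=> phi psi H; rewrite (condp_measurable H).
  rewrite (condp_tower _ _ mS) condp_tower// => phi psi H.
  exact/mS/(agreeS SS').
apply/eqP; rewrite -subr_eq0 -sumrB.
have -> : \sum_(phi in F) ((condp S' phi e c - condp S phi e c) ^+ 2 -
      (condp S' phi e c ^+ 2 - condp S phi e c ^+ 2)) =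
   2 * (\sum_(phi in F) condp S phi e c * condp S phi e c -
   \sum_(phi in F) condp S phi e c * condp S' phi e c).
  by rewrite -sumrB mulr_sumr; apply: eq_bigr => phi _; ring.
by rewrite cross subrr mulr0.
Qed.

Lemma gain_ge0 S S' e : 0 <= gain S S' e.
Proof. by do 2!apply: sumr_ge0 => ? _; apply: sqr_ge0. Qed.

Lemma energyS S S' e : S \subset S' -> energy S e <= energy S' e.
Proof. by move=> SS'; rewrite -subr_ge0 -gainE// gain_ge0. Qed.

Lemma energy_ge0 S e : 0 <= energy S e.
Proof. by do 2!apply: sumr_ge0 => ? _; apply: sqr_ge0. Qed.

Lemma energy_le S e : energy S e <= #|F|%:R.
Proof.
rewrite -sum1_card natr_sum; apply: ler_sum => phi phiF.
rewrite -(sum_condp S e phiF); apply: ler_sum => c _.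
by rewrite expr2 ler_piMl ?condp_ge0// condp_le1.
Qed.

Variable tau : R.
Hypothesis tau_gt0 : 0 < tau.

Definition palette S phi e : {set 'I_3} := [set c | tau <= condp S phi e c].

Lemma palette_measurable S : measurable_on S (palette S).
Proof.
move=> phi psi H; apply/funext => e; apply/setP => c.
by rewrite !inE (condp_measurable H).
Qed.

(** When [f] and [g] get the colours [b] and [c], the edge [e] cannot get [a], so conditioning on
    [f] and [g] drops a probability from at least [tau] to 0: a gain of [tau ^+ 2] at [e]. Given
    [S], [g] gets [c] with probability at least [tau]; after that [f] gets [b] with about its former
    probability, unless there is a gain at [f]. *)
Lemma rainbow_palette_bound S e f g a b c :
    (forall phi, phi \in F -> ~~ uniq [:: phi e; phi f; phi g]) ->
    uniq [:: a; b; c] ->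
  (\sum_(phi in F) [&& a \in palette S phi e, b \in palette S phi f
      & c \in palette S phi g]%:R) * tau ^+ 4
  <= 2 * (gain S (S :|: [set f; g]) e + gain S (S :|: [set g; e]) f).
Proof.
move=> norb abc.
pose h phi : R := [&& a \in palette S phi e, b \in palette S phi f
      & c \in palette S phi g]%:R.
have mh : measurable_on S h.
  by move=> phi psi H; rewrite /h (palette_measurable H).
have hP phi : (h phi = 0) \/ [/\ h phi = 1, tau <= condp S phi e a,
    tau <= condp S phi f b & tau <= condp S phi g c].
  by rewrite /h !inE; case: and3P => [[]|]; [right|left].
have h0 phi : 0 <= h phi by rewrite /h.
rewrite -/(\sum_(phi in F) h phi) -[\sum_(_ in _) _]/(\sum_(phi in F) h phi).
(* With both other edges in [S2], the second gain is the first one for the rotated triangle. *)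
set S1 := S :|: [set f; g]; set S2 := S :|: [set g; e].
have step1 : (\sum_(phi in F) h phi * (phi g == c)%:R * (phi f == b)%:R)
    * tau ^+ 2 <= gain S S1 e.
  rewrite mulr_suml; apply: ler_sum => phi phiF.
  apply: (@le_trans _ _ ((condp S1 phi e a - condp S phi e a) ^+ 2)); last first.
    by rewrite (bigD1 a)//= lerDl; apply: sumr_ge0 => *; apply: sqr_ge0.
  case: (hP phi) => [->|[-> pe _ _]]; first by rewrite !mul0r sqr_ge0.
  case: eqP => gc; last by rewrite mulr0 !mul0r sqr_ge0.
  case: eqP => fb; last by rewrite mulr0 !mul0r sqr_ge0.
  rewrite (_ : condp S1 phi e a = 0); last first.
    rewrite /condp (_ : [set _ in _ | _] = finset.set0) ?cards0 ?mul0r//.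
    apply/setP => psi; rewrite !inE; apply/negP => /andP[/andP[psiF]].
    move=> /agreeP H /eqP ea; have /negP := norb _ psiF; apply.
    by rewrite ea -(H f) -?(H g) ?fb ?gc// !inE eqxx ?orbT.
  by rewrite !mul1r sub0r sqrrN ler_pXn2r// nnegrE ?condp_ge0// ltW.
have step2 : tau ^+ 2 * \sum_(phi in F) h phi <=
    tau * \sum_(phi in F) h phi * (phi g == c)%:R.
  rewrite expr2 -mulrA ler_pM2l// -(condp_tower _ _ mh) mulr_sumr.
  apply: ler_sum => phi _; case: (hP phi) => [->|[-> _ _ H]]; rewrite ?mulr0 ?mul0r//.
  by rewrite mulr1 mul1r.
have mh' : measurable_on S2 (fun phi => h phi * (phi g == c)%:R).
  move=> phi psi H; rewrite (mh phi psi).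
    by move/agreeP: H => ->//; rewrite !inE eqxx orbT.
  by apply: agreeS H; apply: finset.subsetUl.
have tau2 : 0 < tau ^+ 2 by rewrite exprn_gt0.
(* AM-GM: [-x <= x^2 / tau^2 + tau^2 / 4] for the change [x] of the
   conditional probability of [f] having colour [b]. *)
have step3 : tau * \sum_(phi in F) h phi * (phi g == c)%:R <=
    \sum_(phi in F) h phi * (phi g == c)%:R * (phi f == b)%:R
    + gain S S2 f / tau ^+ 2 + tau ^+ 2 / 4 * \sum_(phi in F) h phi.
  rewrite -(condp_tower _ _ mh') !mulr_sumr mulr_suml -!big_split/=.
  apply: ler_sum => phi phiF.
  set x := condp S2 phi f b - condp S phi f b.
  apply: (@le_trans _ _ (h phi * (phi g == c)%:R * condp S2 phi f b
     + x ^+ 2 / tau ^+ 2 + tau ^+ 2 / 4 * h phi)); last first.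
    rewrite lerD2r lerD2l ler_pM2r ?invr_gt0//.
    by rewrite (bigD1 b)//= lerDl; apply: sumr_ge0 => *; apply: sqr_ge0.
  have X0 : 0 <= x ^+ 2 / tau ^+ 2 by rewrite divr_ge0 ?sqr_ge0// ltW.
  case: (hP phi) => [->|[-> _ pf _]]; first by rewrite !(mul0r, mulr0) add0r addr0.
  case: eqP => _; rewrite ?(mul0r, mulr0, mul1r, mulr1, add0r); last first.
    by rewrite addr_ge0// divr_ge0// ltW.
  have : 0 <= (x / tau + tau / 2) ^+ 2 by apply: sqr_ge0.
  have -> : (x / tau + tau / 2) ^+ 2 = x ^+ 2 / tau ^+ 2 + x + tau ^+ 2 / 4.
    by field; rewrite gt_eqF.
  rewrite /x; lra.
set X := \sum_(phi in F) h phi in step2 step3 *.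
set Y := \sum_(phi in F) _ in step1 step3.
(* Chaining the three steps and multiplying by [tau ^+ 2] gives [3/4 * X * tau ^+ 4] at most the sum
   of the two gains, and [4/3 <= 2]. *)
have : tau ^+ 2 * (tau ^+ 2 * X) <=
    tau ^+ 2 * (Y + gain S S2 f / tau ^+ 2 + tau ^+ 2 / 4 * X).
  by rewrite ler_pM2l//; lra.
rewrite !mulrDr [tau ^+ 2 * (gain _ _ _ / _)]mulrC divfK ?gt_eqF//.
have : 0 <= X * tau ^+ 4.
  by rewrite mulr_ge0 ?exprn_ge0 ?sumr_ge0// ltW.
rewrite (_ : tau ^+ 2 * (tau ^+ 2 * X) = X * tau ^+ 4); last by ring.
rewrite (_ : tau ^+ 2 * (tau ^+ 2 / 4 * X) = X * tau ^+ 4 / 4); last by ring.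
rewrite mulrC in step1.
have := gain_ge0 S S1 e; have := gain_ge0 S S2 f.
lra.
Qed.
End Colourings.

(** * Palettes: rainbow transversals, the bound on a triangle, and entropy *)

Definition has_rainbow (A B C : {set 'I_3}) :=
  [exists a, exists b, exists c,
    [&& a \in A, b \in B, c \in C & uniq [:: a; b; c]]].

(* Hall's condition, checked on all triples of subsets of three colours. *)
Lemma no_rainbow_card (A B C : {set 'I_3}) :
  ~~ has_rainbow A B C -> (#|A| * #|B| * #|C| <= 8)%N.
Proof.
pose i0 : 'I_3 := @Ordinal 3 0 isT.
pose i1 : 'I_3 := @Ordinal 3 1 isT.
pose i2 : 'I_3 := @Ordinal 3 2 isT.
have cardE (D : {set 'I_3}) : #|D| = ((i0 \in D) + (i1 \in D) + (i2 \in D))%N.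
  rewrite -sum1_card big_mkcond /= !big_ord_recl big_ord0 /= addn0 addnA.
  by congr (_ + _ + _)%N; rewrite -?[RHS]/(nat_of_bool _);
     [rewrite (_ : ord0 = i0) | rewrite (_ : lift _ _ = i1) | rewrite (_ : lift _ _ = i2)];
     do ?[case: ifP]; try exact: val_inj.
move=> nr.
have nr' a b c : uniq [:: a; b; c] -> [&& a \in A, b \in B & c \in C] = false.
  move=> abc; apply/negP => /and3P[aA bB cC]; case/negP: nr.
  by apply/existsP; exists a; apply/existsP; exists b; apply/existsP; exists c; apply/and4P.
have := nr' i0 i1 i2 isT; have := nr' i0 i2 i1 isT; have := nr' i1 i0 i2 isT.
have := nr' i1 i2 i0 isT; have := nr' i2 i0 i1 isT; have := nr' i2 i1 i0 isT.
rewrite !cardE.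
by do 9!case: (_ \in _).
Qed.

Section Palettes.
Variables (R : realType) (E : finType).
Local Notation col := {ffun E -> 'I_3}.
Implicit Types (S : {set E}) (phi psi : col) (e f g : E) (a b c : 'I_3).
Variable F : {set col}.
Hypothesis F_gt0 : (0 < #|F|)%N.
Variable tau : R.
Hypothesis tau_gt0 : 0 < tau.
Hypothesis tau_le : tau <= 3^-1.

Local Notation palette := (palette F tau).
Local Notation condp := (condp R F).
Local Notation gain := (gain R F).

Lemma palette_gt0 S phi e : phi \in F -> (0 < #|palette S phi e|)%N.
Proof.
move=> phiF; rewrite lt0n; apply/eqP => /cards0_eq P0.
have : \sum_c condp S phi e c < \sum_(c : 'I_3) tau.
  apply: ltr_sum => [|c _]; last first.
    rewrite ltNge; apply/negP => H; have : c \in palette S phi e by rewrite inE.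
    by rewrite P0 inE.
  by apply/hasP; exists ord0; rewrite // mem_index_enum.
rewrite sum_condp// sumr_const card_ord -[_ *+ 3]mulr_natr.
by move: tau_le; lra.
Qed.

Lemma ln_palette S phi e : phi \in F ->
  0 <= ln (#|palette S phi e|%:R : R) <= ln 3.
Proof.
move=> phiF; rewrite ln_ge0 ?ler1n ?palette_gt0//= ler_ln ?posrE ?ltr0n ?palette_gt0//.
by rewrite ler_nat -[X in (_ <= X)%N](card_ord 3) max_card.
Qed.

(** If the palettes have no rainbow transversal, the three logarithms add up to at most [ln 8];
    otherwise they are bounded by [3 * ln 3]. The latter colourings are counted by
    [rainbow_palette_bound], with the factor 2 for each of the 27 colour triples: hence 54. *)
Lemma ln_palette_triangle S e f g :
    (forall phi, phi \in F -> ~~ uniq [:: phi e; phi f; phi g]) ->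
  \sum_(phi in F) (ln (#|palette S phi e|%:R : R) + ln #|palette S phi f|%:R
      + ln #|palette S phi g|%:R)
  <= #|F|%:R * (3 * ln 2) + 3 * ln 3 * (54 / tau ^+ 4) *
     (gain S (S :|: [set f; g]) e + gain S (S :|: [set g; e]) f).
Proof.
move=> norb; set G := gain _ _ _ + _.
have tau4 : 0 < tau ^+ 4 by rewrite exprn_gt0.
have G0 : 0 <= G by rewrite addr_ge0// gain_ge0.
pose bad phi := has_rainbow (palette S phi e) (palette S phi f) (palette S phi g).
have badP : \sum_(phi in F) (bad phi)%:R <= 54 / tau ^+ 4 * G.
  rewrite mulrAC ler_pdivlMr//.
  apply: (@le_trans _ _ ((\sum_(phi in F) \sum_(x : 'I_3 * 'I_3 * 'I_3)
     (uniq [:: x.1.1; x.1.2; x.2])%:R * [&& x.1.1 \in palette S phi e,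
       x.1.2 \in palette S phi f & x.2 \in palette S phi g]%:R) * tau ^+ 4)).
    rewrite ler_pM2r//; apply: ler_sum => phi _.
    have [/existsP[a /existsP[b /existsP[c /and4P[aA bB cC u]]]]|_] :=
      boolP (bad phi); last by apply: sumr_ge0.
    move: u => /= u; rewrite (bigD1 (a, b, c))//= aA bB cC u mulr1 lerDl.
    by apply: sumr_ge0.
  rewrite exchange_big mulr_suml.
  apply: (@le_trans _ _ (\sum_(x : 'I_3 * 'I_3 * 'I_3) 2 * G)).
    apply: ler_sum => -[[a b] c] _ /=.
    have [u|/negPf /= ->] := boolP (uniq [:: a; b; c]); last first.
      by rewrite big1 ?mul0r ?mulr_ge0// => *; rewrite mul0r.
    move: (u) => /= ->; under eq_bigr do rewrite mul1r.
    exact: rainbow_palette_bound.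
  by rewrite sumr_const !card_prod card_ord -[_ *+ _]mulr_natr; lra.
have ln3 : 0 < ln 3 :> R by rewrite ln_gt0// ltr1n.
apply: (@le_trans _ _ (\sum_(phi in F) (3 * ln 2 + 3 * ln 3 * (bad phi)%:R))).
  apply: ler_sum => phi phiF.
  have := ln_palette S e phiF; have := ln_palette S f phiF; have := ln_palette S g phiF.
  have ln2 : 0 <= ln 2 :> R by rewrite ln_ge0// ler1n.
  have [_|nbad] := boolP (bad phi); first by rewrite mulr1 /=; lra.
  move=> _ _ _; rewrite mulr0 addr0.
  rewrite -!lnM ?posrE ?mulr_gt0 ?ltr0n ?palette_gt0// -!natrM.
  rewrite (_ : 3 * ln 2 = ln (8%:R : R)); last first.
    by rewrite (_ : 8%:R = 2 ^+ 3) ?lnXn ?mulr_natl// -natrX.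
  by rewrite ler_ln ?posrE ?ltr0n// ?muln_gt0 ?palette_gt0// ler_nat no_rainbow_card.
rewrite big_split/= sumr_const -mulr_sumr -[_ *+ #|_|]mulr_natl lerD2l -[leRHS]mulrA.
by rewrite ler_pM2l ?mulr_gt0.
Qed.

Variable theta : R.
Hypothesis theta_gt0 : 0 < theta.
Hypothesis theta_lt1 : theta < 1.

(* Gibbs' inequality against the product weights that give a colour of the
   palette the weight [(1 - theta) / #|palette|] and any other colour
   [theta / 3]. *)
Lemma count_le_palette S :
  ln (#|F|%:R : R) <= #|S|%:R * ln 3
    + #|E|%:R * (- ln (1 - theta) + 3 * tau * ln (3 / theta))
    + #|F|%:R^-1 * \sum_(phi in F) \sum_e ln (#|palette S phi e|%:R : R).
Proof.
pose rho phi e c : R := if c \in palette S phi e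
  then (1 - theta) / #|palette S phi e|%:R else theta / 3.
have mrho : measurable_on S rho.
  move=> phi psi H; rewrite /rho; apply/funext => e; apply/funext => c.
  by rewrite (palette_measurable _ _ H).
have N0 : 0 < #|F|%:R :> R by rewrite ltr0n.
have h1 : 0 < 1 - theta by rewrite subr_gt0.
have rho_gt0 phi e c : 0 < rho phi e c.
  rewrite /rho; case: ifP => H; rewrite divr_gt0// ltr0n.
  by apply/card_gt0P; exists c.
have rho_sum phi e : \sum_c rho phi e c <= 1.
  rewrite (bigID (mem (palette S phi e))) /= /rho.
  under eq_bigr => c -> do [].
  under [X in _ + X]eq_bigr => c /negPf -> do [].
  rewrite !sumr_const -[X in X + _]mulr_natr -[X in _ + X]mulr_natr.
  apply: (@le_trans _ _ ((1 - theta) + theta)); last by rewrite subrK.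
  apply: lerD.
    have [/eqP|/negPf n0] := boolP (#|palette S phi e| == 0%N).
      by move=> ->; rewrite mulr0 ltW.
    by rewrite divfK// pnatr_eq0 n0.
  rewrite mulrAC ler_pdivrMr// ler_pM2l// ler_nat.
  by rewrite -[X in (_ <= X)%N](card_ord 3) max_card.
apply: le_trans (gibbs_count F_gt0 mrho rho_gt0 rho_sum) _.
rewrite -addrA lerD2l -ler_pdivlMl ?invr_gt0// invrK mulrDr mulVKf ?gt_eqF//.
have K0 : 0 < ln (3 / theta).
  by rewrite ln_gt0// ltr_pdivlMr// mul1r; apply: lt_trans theta_lt1 _; rewrite ltr1n.
(* A colour in the palette costs the first two terms; one outside costs [ln (3 / theta)]. *)
have Hp phi e : phi \in F -> - ln (rho phi e (phi e)) <= ln #|palette S phi e|%:R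
    - ln (1 - theta) + ln (3 / theta) * (phi e \notin palette S phi e)%:R.
  move=> phiF; have p0 := palette_gt0 S e phiF.
  rewrite /rho; case: ifPn => H /=; first by rewrite mulr0 addr0 ln_div ?posrE ?ltr0n//; lra.
  rewrite mulr1 !ln_div ?posrE//.
  have := ln_palette S e phiF.
  have : ln (1 - theta) <= 0 by rewrite ln_le0// lerBlDr lerDl ltW.
  by lra.
(* By the tower property the indicators become conditional probabilities; each of the three colours
   has less than [tau] when outside the palette. *)
have notin e : \sum_(phi in F) (phi e \notin palette S phi e)%:R <= #|F|%:R * (3 * tau).
  have -> : \sum_(phi in F) (phi e \notin palette S phi e)%:R =
     \sum_c \sum_(phi in F) (c \notin palette S phi e)%:R * condp S phi e c.
    under [RHS]eq_bigr => c _.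
      rewrite condp_tower; last by move=> phi psi H; rewrite (palette_measurable _ _ H).
      over.
    rewrite exchange_big; apply: eq_bigr => phi _.
    rewrite (bigD1 (phi e))//= eqxx mulr1 big1 ?addr0// => c /negPf.
    by rewrite eq_sym => ->; rewrite mulr0.
  apply: (@le_trans _ _ (\sum_(c : 'I_3) #|F|%:R * tau)); last first.
    by rewrite sumr_const card_ord -[_ *+ 3]mulr_natr; lra.
  apply: ler_sum => c _; rewrite mulr_natl -sumr_const; apply: ler_sum => phi _.
  by rewrite inE mulr_natl; have [H|H] := leP tau (condp S phi e c); exact: ltW.
apply: (@le_trans _ _ (\sum_(phi in F) \sum_e (ln #|palette S phi e|%:R
    - ln (1 - theta) + ln (3 / theta) * (phi e \notin palette S phi e)%:R))).
  by apply: ler_sum => phi phiF; apply: ler_sum => e _; apply: Hp.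
under eq_bigr do rewrite 2!big_split/=.
rewrite 2!big_split/= [leRHS]addrC -addrA lerD2l.
under eq_bigr do rewrite sumr_const.
rewrite sumr_const -mulrnA -[(- ln _) *+ _]mulr_natr natrM mulrDr mulrDr.
apply: lerD; first by rewrite le_eqVlt; apply/orP; left; apply/eqP; rewrite -[#|_|]/#|E|; ring.
rewrite exchange_big/=.
under eq_bigr do rewrite -mulr_sumr.
apply: (@le_trans _ _ (\sum_(e : E) ln (3 / theta) * (#|F|%:R * (3 * tau)))).
  by apply: ler_sum => e _; rewrite ler_pM2l.
rewrite sumr_const -[X in _ *+ X]/#|E| -[_ *+ _]mulr_natr.
by rewrite le_eqVlt; apply/orP; left; apply/eqP; ring.
Qed.
End Palettes.

(** * Counting colourings without rainbow triangles *)

Section TriangleSystem.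
Variables (R : realType) (E : finType) (k : nat).
Local Notation col := {ffun E -> 'I_3}.
Variable F : {set col}.
Hypothesis F_gt0 : (0 < #|F|)%N.
(** For a graph, [t] is the relation of forming a triangle, [b e f g] is the block of the apex
    opposite [e], and [B i] is the set of edges meeting block [i]. An edge meets at most two blocks,
    which is [sumB]. *)
Variables (t : E -> E -> E -> bool) (b : E -> E -> E -> 'I_k).
Variable B : 'I_k -> {set E}.
Hypothesis tC : forall e f g, t e f g = t f g e.
Hypothesis tB : forall e f g, t e f g -> [set f; g] \subset B (b e f g).
Hypothesis sumB : (\sum_i #|B i| <= 2 * #|E|)%N.
Hypothesis rainbow_free : forall phi e f g, phi \in F -> t e f g ->
  ~~ uniq [:: phi e; phi f; phi g].

Local Notation tri := (fun x : E * E * E => t x.1.1 x.1.2 x.2).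

Definition block_degree (e : E) (i : 'I_k) : nat :=
  #|[set x : E * E | t e x.1 x.2 && (b e x.1 x.2 == i)]|.

Lemma sum_tri_rot (V : zmodType) (h : E -> E -> E -> V) :
  \sum_(x | tri x) h x.1.2 x.2 x.1.1 = \sum_(x | tri x) h x.1.1 x.1.2 x.2.
Proof.
rewrite [RHS](reindex (fun x : E * E * E => (x.1.2, x.2, x.1.1))) /=.
  by apply: eq_bigl => -[[e f] g] /=; rewrite tC.
exists (fun x : E * E * E => (x.2, x.1.1, x.1.2)); first by move=> [[e f] g].
by move=> [[e f] g].
Qed.

Lemma sum_tri_block (h : E -> 'I_k -> R) :
  \sum_(x | tri x) h x.1.1 (b x.1.1 x.1.2 x.2) =
  \sum_e \sum_i (block_degree e i)%:R * h e i.
Proof.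
transitivity (\sum_e \sum_(y : E * E | t e y.1 y.2) h e (b e y.1 y.2)).
  rewrite pair_big_dep /=.
  rewrite (reindex (fun z : E * (E * E) => (z.1, z.2.1, z.2.2))) /=; last first.
    by exists (fun x : E * E * E => (x.1.1, (x.1.2, x.2))) => [[e [f g]]|[[e f] g]].
  by apply: eq_big => [[e [f g]]|[e [f g]]].
apply: eq_bigr => e _.
rewrite (partition_big (fun y : E * E => b e y.1 y.2) predT)//=.
apply: eq_bigr => i _.
rewrite (eq_bigr (fun=> h e i)) => [|y /andP[_ /eqP->]//].
rewrite sumr_const mulr_natl; congr (_ *+ _).
by apply: eq_card => y; rewrite !inE.
Qed.

Variables (lambda Delta : R).
Hypothesis lambda_gt0 : 0 < lambda.
Hypothesis Delta_gt0 : 0 < Delta.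
Hypothesis k_gt0 : (0 < k)%N.

Local Notation N := (#|F|%:R : R).
Local Notation energy := (energy R F).

Definition block_defect : R := \sum_e \sum_i `|(block_degree e i)%:R - Delta|.

(* A maximizer of the total energy minus a linear cost: no block gains more
   energy than its cost, while the maximizer itself cannot cost more than the
   total energy available. *)
Lemma exists_pinning : exists S : {set E},
  #|S|%:R <= #|E|%:R / lambda /\
  \sum_i \sum_e (energy (S :|: B i) e - energy S e) <= 2 * lambda * #|E|%:R * N.
Proof.
have N0 : 0 < N by rewrite ltr0n.
pose U (I : {set 'I_k}) := (\bigcup_(i in I) B i)%SET.
pose J (I : {set 'I_k}) := \sum_e energy (U I) e - lambda * N * \sum_(i in I) #|B i|%:R.
case: (@arg_maxP _ _ _ finset.set0 xpredT J isT) => I _ Imax.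
exists (U I); split.
  apply: (@le_trans _ _ (\sum_(i in I) #|B i|%:R)).
    rewrite -natr_sum ler_nat /U.
    elim/big_rec2: _ => [|i m X _ IH]; first by rewrite cards0.
    apply: leq_trans (leq_card_setU _ _) _.
    by rewrite leq_add2l.
  rewrite ler_pdivlMr// -(ler_pM2r N0).
  have : J finset.set0 <= J I by exact: Imax.
  rewrite /J big_set0 mulr0 subr0.
  have : 0 <= \sum_e energy (U finset.set0) e.
    by apply: sumr_ge0 => *; apply: energy_ge0.
  have : \sum_e energy (U I) e <= #|E|%:R * N.
    rewrite mulr_natl -sumr_const; apply: ler_sum => e _; exact: energy_le.
  by move=> H1 H2 H3; lra.
apply: (@le_trans _ _ (\sum_i lambda * N * #|B i|%:R)); last first.
  rewrite -mulr_sumr -natr_sum.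
  rewrite (_ : 2 * lambda * #|E|%:R * N = lambda * N * (2 * #|E|)%:R); last first.
    by rewrite natrM; ring.
  by rewrite ler_pM2l ?mulr_gt0// ler_nat.
apply: ler_sum => i _; have [iI|iI] := boolP (i \in I).
  rewrite big1 ?mulr_ge0 ?(ltW lambda_gt0)// => e _.
  by rewrite (finset.setUidPl _) ?subrr//; apply: finset.bigcup_sup.
(* Adding block [i] to [I] does not raise [J], so its energy gain is at most its cost
   [lambda * N * #|B i|]. *)
have : J (i |: I)%SET <= J I by exact: Imax.
rewrite /J /U !big_setU1//= finset.setUC.
by rewrite sumrB; lra.
Qed.

Variables (tau theta : R).
Hypothesis tau_gt0 : 0 < tau.
Hypothesis tau_le : tau <= 3^-1.
Hypothesis theta_gt0 : 0 < theta.
Hypothesis theta_lt1 : theta < 1.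

(** The pinned edges cost [ln 3 / lambda] per edge, and the terms in [theta] and [tau] come from
    [count_le_palette]. The palette term is averaged over triangles: an edge lies in about
    [k * Delta] of them, up to [block_defect]. *)
Theorem ln_count_rainbow_free :
  ln N <= #|E|%:R * (ln 3 / lambda - ln (1 - theta) + 3 * tau * ln (3 / theta)
       + ln 2 + 216 * ln 3 * lambda / (tau ^+ 4 * k%:R))
    + (ln 2 + ln 3 + 108 * ln 3 / tau ^+ 4) * (block_defect / (k%:R * Delta)).
Proof.
have [S [cardS gainS]] := exists_pinning.
have N0 : 0 < N by rewrite ltr0n.
have ln3 : 0 < ln 3 :> R by rewrite ln_gt0// ltr1n.
have ln2 : 0 < ln 2 :> R by rewrite ln_gt0// ltr1n.
have K0 : 0 < k%:R :> R by rewrite ltr0n.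
have tau4 : 0 < tau ^+ 4 by rewrite exprn_gt0.
pose X e : R := \sum_(phi in F) ln (#|palette F tau S phi e|%:R : R).
have X_ge0 e : 0 <= X e.
  by apply: sumr_ge0 => phi phiF; case/andP: (ln_palette tau_le S e phiF).
have X_le e : X e <= N * ln 3.
  rewrite mulr_natl -sumr_const; apply: ler_sum => phi phiF.
  by case/andP: (ln_palette tau_le S e phiF).
pose G e i := energy (S :|: B i) e - energy S e.
have G_ge0 e i : 0 <= G e i by rewrite subr_ge0 energyS// finset.subsetUl.
have G_le e i : G e i <= N.
  by rewrite lerBlDr ler_wpDr ?energy_ge0// energy_le.
(* Replaces a block degree by [Delta], charging the deviation at the maximal value [M]. *)
have Dle e i (x M : R) : 0 <= x <= M ->
    (block_degree e i)%:R * x <= Delta * x + `|(block_degree e i)%:R - Delta| * M.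
  move=> /andP[x0 xM]; rewrite -lerBlDl -mulrBl.
  apply: (le_trans (ler_norm _)); rewrite normrM (ger0_norm x0).
  by rewrite ler_wpM2l.
(* Energy is monotone, so conditioning on [f] and [g] gains at most as much as conditioning on the
   whole block containing both. That gain depends only on [e] and the block, and [exists_pinning]
   applies. *)
have gain_sum : \sum_(x | tri x) gain R F S (S :|: [set x.1.2; x.2]) x.1.1
    <= Delta * (2 * lambda * #|E|%:R * N) + block_defect * N.
  apply: (@le_trans _ _ (\sum_(x | tri x) G x.1.1 (b x.1.1 x.1.2 x.2))).
    apply: ler_sum => -[[e f] g] /= efg.
    rewrite gainE ?finset.subsetUl// lerD2r energyS//.
    by apply: finset.setUS; exact: tB.
  rewrite sum_tri_block.
  apply: (@le_trans _ _ (\sum_e \sum_i (Delta * G e i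
      + `|(block_degree e i)%:R - Delta| * N))).
    by apply: ler_sum => e _; apply: ler_sum => i _; rewrite Dle// G_ge0 G_le.
  under eq_bigr do rewrite big_split/= -mulr_sumr -mulr_suml.
  rewrite big_split/= -mulr_sumr -mulr_suml lerD2r ler_pM2l//.
  by rewrite exchange_big.
have tri_sum : \sum_(x | tri x) (1 : R) <= #|E|%:R * (k%:R * Delta) + block_defect.
  rewrite (sum_tri_block (fun _ _ => 1)).
  apply: (@le_trans _ _ (\sum_e \sum_i (Delta + `|(block_degree e i)%:R - Delta|))).
    apply: ler_sum => e _; apply: ler_sum => i _.
    by have := Dle e i 1 1; rewrite ler01 lexx !mulr1; apply.
  under eq_bigr do rewrite big_split/= sumr_const card_ord.
  by rewrite big_split/= sumr_const lerD2r -[Delta *+ k]mulr_natl -[_ *+ #|_|]mulr_natl.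
(* By rotation the three palette sums agree, as do the two gain sums; dividing by 3 leaves
   [54 * 2 = 108]. *)
have X_tri : \sum_(x | tri x) X x.1.1 <= N * ln 2 * \sum_(x | tri x) 1
    + 108 * ln 3 / tau ^+ 4 *
      \sum_(x | tri x) gain R F S (S :|: [set x.1.2; x.2]) x.1.1.
  have r1 : \sum_(x | tri x) X x.1.2 = \sum_(x | tri x) X x.1.1.
    exact: (sum_tri_rot (fun e _ _ => X e)).
  have r2 : \sum_(x | tri x) X x.2 = \sum_(x | tri x) X x.1.1.
    by rewrite -r1 -(sum_tri_rot (fun _ f _ => X f)).
  have r3 : \sum_(x | tri x) gain R F S (S :|: [set x.2; x.1.1]) x.1.2 =
            \sum_(x | tri x) gain R F S (S :|: [set x.1.2; x.2]) x.1.1.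
    exact: (sum_tri_rot (fun e f g => gain R F S (S :|: [set f; g]) e)).
  have : \sum_(x | tri x) (X x.1.1 + X x.1.2 + X x.2) <=
     \sum_(x | tri x) (N * (3 * ln 2) * 1 + 3 * ln 3 * (54 / tau ^+ 4) *
      (gain R F S (S :|: [set x.1.2; x.2]) x.1.1 +
       gain R F S (S :|: [set x.2; x.1.1]) x.1.2)).
    apply: ler_sum => -[[e f] g] /= efg; rewrite mulr1 /X -[X in X + _]big_split -[leLHS]big_split /=.
    by apply: ln_palette_triangle => // phi phiF; apply: rainbow_free.
  rewrite !big_split/= -!mulr_sumr big_split/= r1 r2 r3.
  set x1 := \sum_(_ | _) _; set x2 := \sum_(_ | _) 1; set x3 := \sum_(_ | _) _.
  by move=> H; lra.
have X_sum : k%:R * Delta * \sum_e X e <= \sum_(x | tri x) X x.1.1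
    + block_defect * (N * ln 3).
  rewrite (sum_tri_block (fun e _ => X e)) mulr_sumr mulr_suml -big_split/=.
  apply: ler_sum => e _; rewrite mulr_suml -big_split/=.
  rewrite (_ : k%:R * Delta * X e = \sum_(i < k) Delta * X e); last first.
    by rewrite sumr_const card_ord -mulrA mulr_natl.
  apply: ler_sum => i _.
  rewrite -lerBlDl -mulrBl; apply: (le_trans (ler_norm _)).
  by rewrite normrM (ger0_norm (X_ge0 e)) distrC ler_wpM2l.
have Xfinal : \sum_e X e <= N * (#|E|%:R * (ln 2 + 216 * ln 3 * lambda / (tau ^+ 4 * k%:R))
    + (ln 2 + ln 3 + 108 * ln 3 / tau ^+ 4) * (block_defect / (k%:R * Delta))).
  have KD : 0 < k%:R * Delta by rewrite mulr_gt0.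
  rewrite -(ler_pM2l KD); apply: (le_trans X_sum).
  apply: (@le_trans _ _ (N * ln 2 * (#|E|%:R * (k%:R * Delta) + block_defect) +
     108 * ln 3 / tau ^+ 4 * (Delta * (2 * lambda * #|E|%:R * N) + block_defect * N)
     + block_defect * (N * ln 3))).
    rewrite lerD2r; apply: (le_trans X_tri).
    by rewrite lerD// ler_pM2l// ?divr_gt0 ?mulr_gt0.
  rewrite le_eqVlt; apply/orP; left; apply/eqP; field.
  by rewrite !gt_eqF.
apply: le_trans (count_le_palette F_gt0 tau_gt0 tau_le theta_gt0 theta_lt1 S) _.
rewrite exchange_big /= -/(\sum_e X e).
have : #|S|%:R * ln 3 <= #|E|%:R * (ln 3 / lambda).
  by rewrite mulrCA [leRHS]mulrC ler_pM2r.
have : N^-1 * \sum_e X e <= #|E|%:R * (ln 2 + 216 * ln 3 * lambda / (tau ^+ 4 * k%:R))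
    + (ln 2 + ln 3 + 108 * ln 3 / tau ^+ 4) * (block_defect / (k%:R * Delta)).
  by rewrite ler_pdivrMl.
rewrite !mulrDr mulrN; set Y := N^-1 * _; lra.
Qed.
End TriangleSystem.

(** * Independent random sets and the Efron-Stein inequality *)

Section BernoulliProduct.
Variables (R : realType) (U : finType) (p : R).
Hypothesis p01 : 0 <= p <= 1.
Implicit Types (s : seq U) (f g : {set U} -> R) (A B S : {set U}) (x y : U).

(* [Ex s f A] is the expectation of [f] at the random set obtained from [A] by
   resampling the membership of the elements of [s]: each of them is put in the
   set with probability [p] independently. *)
Fixpoint Ex s f A : R :=
  if s is x :: s' then p * Ex s' f (x |: A) + (1 - p) * Ex s' f (A :\ x)
  else f A.

Let p_ge0 : 0 <= p. Proof. by case/andP: p01. Qed.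
Let q_ge0 : 0 <= 1 - p. Proof. by rewrite subr_ge0; case/andP: p01. Qed.

Lemma Ex_le s f g A : (forall B, f B <= g B) -> Ex s f A <= Ex s g A.
Proof.
by move=> fg; elim: s A => //= x s IH A; rewrite lerD// ler_wpM2l.
Qed.

Lemma eq_Ex s f g A : f =1 g -> Ex s f A = Ex s g A.
Proof. by move=> /funext ->. Qed.

Lemma Ex_cst s (c : R) A : Ex s (fun=> c) A = c.
Proof. by elim: s A => //= x s IH A; rewrite !IH; ring. Qed.

Lemma ExD s f g A : Ex s (fun B => f B + g B) A = Ex s f A + Ex s g A.
Proof. by elim: s A => //= x s IH A; rewrite !IH; ring. Qed.

Lemma ExZ s (c : R) f A : Ex s (fun B => c * f B) A = c * Ex s f A.
Proof. by elim: s A => //= x s IH A; rewrite !IH; ring. Qed.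

Lemma ExB s f g A : Ex s (fun B => f B - g B) A = Ex s f A - Ex s g A.
Proof. by elim: s A => //= x s IH A; rewrite !IH; ring. Qed.

Lemma Ex_sum s (I : Type) (r : seq I) (P : pred I) (F : I -> {set U} -> R) A :
  Ex s (fun B => \sum_(i <- r | P i) F i B) A = \sum_(i <- r | P i) Ex s (F i) A.
Proof.
elim: r => [|i r IH].
  by rewrite big_nil -[RHS](Ex_cst s 0 A); apply: eq_Ex => B; rewrite big_nil.
rewrite big_cons -IH; case: ifP => Pi; last first.
  by apply: eq_Ex => B; rewrite big_cons Pi.
by rewrite -ExD; apply: eq_Ex => B; rewrite big_cons Pi.
Qed.

Lemma Ex_ge0 s f A : (forall B, 0 <= f B) -> 0 <= Ex s f A.
Proof. by move=> f0; rewrite -(Ex_cst s 0 A); apply: Ex_le. Qed.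

Lemma Ex_jensen s f A : Ex s f A ^+ 2 <= Ex s (fun B => f B ^+ 2) A.
Proof.
have := Ex_ge0 s A (fun B => sqr_ge0 (f B - Ex s f A)).
rewrite (eq_Ex _ _ (g := fun B => f B ^+ 2 - (2 * Ex s f A) * f B + Ex s f A ^+ 2)).
  by rewrite ExD Ex_cst ExB ExZ; lra.
by move=> B; ring.
Qed.

Lemma Ex_variance s f A :
  Ex s (fun B => (f B - Ex s f A) ^+ 2) A = Ex s (fun B => f B ^+ 2) A - Ex s f A ^+ 2.
Proof.
rewrite (eq_Ex _ _ (g := fun B => f B ^+ 2 - (2 * Ex s f A) * f B + Ex s f A ^+ 2)).
  by rewrite ExD Ex_cst ExB ExZ; ring.
by move=> B; ring.
Qed.

Lemma Ex_setU1 s f A x : x \notin s ->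
  Ex s f (x |: A) = Ex s (fun B => f (x |: B)) A.
Proof.
elim: s A => //= y s IH A; rewrite inE negb_or => /andP[xy xs].
rewrite -!IH//; congr (_ * _ + _ * _); first by rewrite finset.setUCA.
by congr (Ex _ _ _); apply/setP => z; rewrite !inE; case: eqP => // ->;
   rewrite eq_sym (negPf xy).
Qed.

Lemma Ex_setD1 s f A x : x \notin s ->
  Ex s f (A :\ x) = Ex s (fun B => f (B :\ x)) A.
Proof.
elim: s A => //= y s IH A; rewrite inE negb_or => /andP[xy xs].
rewrite -!IH//; congr (_ * _ + _ * _); congr (Ex _ _ _); apply/setP => z;
  rewrite !inE; last by rewrite andbCA.
by case: eqP => // ->; rewrite eq_sym (negPf xy).
Qed.

(** Induction by the law of total variance for the first coordinate [x]. The variances given [x] are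
    bounded by induction; the variance of the two conditional means is
    [p * (1 - p) * (a1 - a0) ^+ 2], bounded by Jensen and [1 - p <= 1]. *)
Theorem efron_stein s f A : uniq s ->
  Ex s (fun B => f B ^+ 2) A - Ex s f A ^+ 2 <=
  p * \sum_(x <- s) Ex s (fun B => (f (x |: B) - f (B :\ x)) ^+ 2) A.
Proof.
elim: s A => /= [|x s IH] A; first by rewrite big_nil mulr0 subrr.
move=> /andP[xs us]; rewrite big_cons.
have H1 := IH (x |: A) us; have H0 := IH (A :\ x) us.
pose D := fun y B => (f (y |: B) - f (B :\ y)) ^+ 2.
rewrite big_split/= -!mulr_sumr -/(D x).
rewrite -[\sum_(_ <- _) Ex _ _ (x |: A)]/(\sum_(y <- s) Ex s (D y) (x |: A)) in H1 *.
rewrite -[\sum_(_ <- _) Ex _ _ (A :\ x)]/(\sum_(y <- s) Ex s (D y) (A :\ x)) in H0 *.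
move: H1 H0; set V1 := \sum_(_ <- _) _; set V0 := \sum_(_ <- _) _ => H1 H0.
(* [D x B] does not depend on whether [x] lies in [B]. *)
have Dx1 : Ex s (D x) (x |: A) = Ex s (D x) A.
  rewrite Ex_setU1//; apply: eq_Ex => B; rewrite /D; congr ((f _ - f _) ^+ 2);
  by apply/setP => z; rewrite !inE; case: eqP.
have Dx0 : Ex s (D x) (A :\ x) = Ex s (D x) A.
  rewrite Ex_setD1//; apply: eq_Ex => B; rewrite /D; congr ((f _ - f _) ^+ 2);
  by apply/setP => z; rewrite !inE; case: eqP.
have := Ex_jensen s (fun B => f (x |: B) - f (B :\ x)) A.
rewrite ExB -Ex_setU1// -Ex_setD1// Dx1 Dx0 -/(D x).
set a1 := Ex s f (x |: A); set a0 := Ex s f (A :\ x).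
set b1 := Ex s _ (x |: A); set b0 := Ex s _ (A :\ x); set d := Ex s (D x) A.
move=> Hd; rewrite -/a1 -/b1 in H1; rewrite -/a0 -/b0 in H0.
have d0 : 0 <= d by apply: Ex_ge0 => B; apply: sqr_ge0.
have e1 := ler_wpM2l p_ge0 H1; have e0 := ler_wpM2l q_ge0 H0.
have e2 : p * (1 - p) * (a1 - a0) ^+ 2 <= p * d.
  rewrite -mulrA ler_wpM2l//; apply: (@le_trans _ _ ((1 - p) * d)).
    by rewrite ler_wpM2l.
  by rewrite ler_piMl// lerBlDr lerDl.
rewrite (_ : _ - _ = p * (b1 - a1 ^+ 2) + (1 - p) * (b0 - a0 ^+ 2)
    + p * (1 - p) * (a1 - a0) ^+ 2); last by ring.
lra.
Qed.

Lemma Ex_chebyshev s f A (m a V : R) : 0 < a ->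
    Ex s f A + a <= m -> Ex s (fun B => f B ^+ 2) A - Ex s f A ^+ 2 <= V ->
  Ex s (fun B => (m < f B)%R%:R) A <= V / a ^+ 2.
Proof.
move=> a0 fm; rewrite -Ex_variance => hV.
rewrite ler_pdivlMr ?exprn_gt0// mulrC -ExZ; apply: le_trans hV.
apply: Ex_le => B; case: ltP => mf /=; last by rewrite mulr0 sqr_ge0.
rewrite mulr1 ler_pXn2r// ?nnegrE; lra.
Qed.

Lemma Ex_subset s S A : uniq s ->
  Ex s (fun B => (S \subset B)%:R) A =
  p ^+ #|[set x in S | x \in s]| * (S :\: [set x in s] \subset A)%:R.
Proof.
elim: s A => /= [|x s IH] A.
  rewrite (_ : [set _ in _ | _] = finset.set0) ?cards0 ?mul1r; last first.
    by apply/setP => z; rewrite !inE andbF.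
  rewrite (_ : S :\: _ = S)//; last by apply/setP => z; rewrite !inE.
move=> /andP[xs us]; rewrite !IH//.
have E1 : (S :\: [set y in s] \subset x |: A) = (S :\: [set y in x :: s] \subset A).
  apply/fintype.subsetP/fintype.subsetP => H y.
    rewrite !inE negb_or -andbA => /and3P[yx ys yS].
    by have := H y; rewrite !inE ys yS (negPf yx) /=; apply.
  rewrite !inE => /andP[ys yS]; case: eqP => //= /eqP yx.
  by apply: H; rewrite !inE negb_or yx ys yS.
have [xS|xS] := boolP (x \in S).
  rewrite (_ : (_ \subset A :\ x) = false); last first.
    apply/negP => /fintype.subsetP /(_ x); rewrite !inE xS xs eqxx.
    by move=> /(_ isT).
  rewrite !mulr0 addr0 mulrA -exprS; congr (p ^+ _ * _).
    rewrite (cardsD1 x [set y in S | y \in x :: s]) !inE xS eqxx /= add1n.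
    congr (_.+1); apply: eq_card => y; rewrite !inE.
    by case: eqP => // ->; rewrite (negPf xs) andbF.
  by rewrite E1.
have -> : [set y in S | y \in x :: s] = [set y in S | y \in s].
  by apply/setP => y; rewrite !inE; case: eqP => // ->; rewrite (negPf xS).
have E0 : (S :\: [set y in s] \subset A :\ x) = (S :\: [set y in x :: s] \subset A).
  apply/fintype.subsetP/fintype.subsetP => H y.
    rewrite !inE negb_or -andbA => /and3P[yx ys yS].
    by have := H y; rewrite !inE ys yS (negPf yx) /=; apply.
  rewrite !inE => /andP[ys yS].
  have yx : y != x by apply: contraNneq xS => <-.
  by rewrite yx H// !inE negb_or yx ys yS.
by rewrite E1 E0; ring.
Qed.

(** Turns the recursive expectation into a weighted sum over subsets, the form of [gnp_prob]. The
    subsets are split by whether they contain the head of the list. *)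
Lemma Ex_sumE s f A : uniq s ->
  Ex s f A = \sum_(B : {set U} | B \subset [set x in s])
    (\prod_(x <- s) (if x \in B then p else 1 - p)) * f (B :|: (A :\: [set x in s])).
Proof.
elim: s A => /= [|x s IH] A.
  have -> : [set x : U in [::]] = finset.set0 by apply/setP => z; rewrite !inE.
  rewrite (big_pred1 finset.set0) => [|B]; last by rewrite finset.subset0.
  by rewrite big_nil mul1r finset.setD0 finset.set0U.
move=> /andP[xs us]; rewrite !IH// !mulr_sumr.
rewrite [RHS](bigID (fun B : {set U} => x \in B)) /=; congr (_ + _).
  rewrite [RHS](reindex_onto (fun B => x |: B) (fun B => B :\ x)) /=; last first.
    by move=> B /andP[_ xB]; rewrite finset.setD1K.
  apply: eq_big => [B|B Bs].
    rewrite setU11 andbT; apply/idP/idP => [/fintype.subsetP H|].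
      have xB : x \notin B by apply: contra xs => /H; rewrite inE.
      rewrite setU1K// eqxx andbT; apply/fintype.subsetP => y.
      by rewrite !inE => /orP[->//|/H]; rewrite inE => ->; rewrite orbT.
    move=> /andP[/fintype.subsetP H /eqP E]; apply/fintype.subsetP => y yB.
    have yx : y != x by move: yB; rewrite -E !inE => /andP[].
    by have := H y; rewrite !inE yB (negPf yx) orbT; apply.
  rewrite big_cons setU11 mulrA; congr (_ * _ * f _).
    rewrite big_seq [RHS]big_seq; apply: eq_bigr => y ys.
    by rewrite !inE (_ : y == x = false)//; apply: contraNF xs => /eqP <-.
  apply/setP => y; rewrite !inE; case: eqP => [->|] /=; last by [].
  by rewrite xs orbT.
apply: eq_big => [B|B Bs].
  apply/idP/idP => [/fintype.subsetP H|/andP[/fintype.subsetP H xB]].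
    apply/andP; split; last by apply: contra xs => /H; rewrite inE.
    by apply/fintype.subsetP => y /H; rewrite !inE => ->; rewrite orbT.
  apply/fintype.subsetP => y yB; have := H y yB; rewrite !inE.
  by case: eqP => // E; move: yB xB; rewrite E => ->.
have xB : (x \in B) = false.
  by apply: contraNF xs => xB; move/fintype.subsetP: Bs => /(_ x xB); rewrite inE.
rewrite big_cons xB mulrA; congr (_ * f _); apply/setP => y; rewrite !inE.
by case: eqP => [->|]; rewrite ?andbF ?andbT.
Qed.
End BernoulliProduct.

(** * Probabilities in the random graph as expectations over random edge sets *)

Section RandomGraphExpectation.
Variables (R : realType) (n : nat) (p : R).

Definition gnp_Ex (f : {set {set 'I_n}} -> R) : R :=
  Ex p (enum (vpairs n)) f finset.set0.

Lemma gnp_probE (P : pred {set {set 'I_n}}) :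
  gnp_prob p (fun G : sgraph n => P (edges G)) = gnp_Ex (fun B => (P B)%:R).
Proof.
rewrite /gnp_Ex Ex_sumE ?enum_uniq//.
have -> : [set x in enum (vpairs n)] = vpairs n.
  by apply/setP => e; rewrite inE mem_enum.
rewrite (reindex_omap (@edges n) insub) /=; last by move=> B BV; rewrite insubT.
rewrite /gnp_prob big_mkcond; apply: eq_big => [G|G _].
  by rewrite (valK G) eqxx edges_vpairs.
rewrite finset.set0D finset.setU0 /gnp_weight big_enum.
by case: (P _); rewrite ?mulr1 ?mulr0.
Qed.
End RandomGraphExpectation.

(** * Codegrees in the random graph *)

Section Codegrees.
Variables (R : realType) (n : nat).
Implicit Types (e f : {set 'I_n}) (u v w : 'I_n) (B S : {set {set 'I_n}}).
Implicit Types (W : {set 'I_n}).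

Definition cherry w e : {set {set 'I_n}} := [set [set u; w] | u in e].

(** The common neighbours in [W] of the two ends of [e], whether or not [e] itself lies in [B]. *)
Definition apices W e B : {set 'I_n} :=
  [set w in W | (w \notin e) && (cherry w e \subset B)].

Definition codegree W e B : R := #|apices W e B|%:R.

Lemma vpairsP e : reflect (exists u v, u != v /\ e = [set u; v]) (e \in vpairs n).
Proof.
by rewrite inE; exact: cards2P.
Qed.

Lemma pair_in_vpairs u v : u != v -> [set u; v] \in vpairs n.
Proof. by move=> uv; apply/vpairsP; exists u, v. Qed.

Lemma card_vpairs : (#|vpairs n| = 'C(n, 2))%N.
Proof. by rewrite card_draws card_ord. Qed.

Lemma card_vpairs_le : (#|vpairs n| <= n ^ 2)%N.
Proof.
rewrite card_vpairs bin2 -mulnn; apply: leq_trans (_ : (n * n)./2 <= _)%N.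
  by rewrite half_leq// leq_mul2l leq_pred orbT.
by rewrite -[X in (_ <= X)%N]doubleK half_leq// -addnn leq_addr.
Qed.

Lemma cherry_vpairs w e : w \notin e -> cherry w e \subset vpairs n.
Proof.
move=> we; apply/fintype.subsetP => _ /imsetP[u ue ->].
by apply: pair_in_vpairs; apply: contraNneq we => <-.
Qed.

Lemma card_cherry w e : e \in vpairs n -> w \notin e -> #|cherry w e| = 2%N.
Proof.
move=> eV we; rewrite card_in_imset; first by move: eV; rewrite inE => /eqP.
move=> u u' ue u'e /setP /(_ u); rewrite !inE eqxx /= => /esym /orP[/eqP//|/eqP uw].
by move: we; rewrite -uw ue.
Qed.

Lemma cherry_notin w e : e \notin cherry w e \/ w \in e.
Proof.
have [we|we] := boolP (w \in e); [by right|left].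
apply/imsetP => -[u _ E]; case/negP: we; rewrite E !inE eqxx orbT //.
Qed.

Lemma cherry_disjoint w w' e : w != w' -> w \notin e -> [disjoint cherry w e & cherry w' e].
Proof.
move=> ww' we; rewrite -setI_eq0; apply/eqP/setP => c; rewrite !inE.
apply/negP => /andP[/imsetP[u ue ->] /imsetP[u' u'e /setP /(_ w)]].
rewrite !inE eqxx orbT (negPf ww') orbF => /esym/eqP E.
by move: we; rewrite E u'e.
Qed.

Lemma codegreeE W e B :
  codegree W e B = \sum_(w in W | w \notin e) (cherry w e \subset B)%:R.
Proof.
rewrite /codegree -sum1_card natr_sum big_mkcond [RHS]big_mkcond /=.
apply: eq_bigr => w _; rewrite !inE.
by case: (w \in W) => //=; case: (w \in e) => //=; case: (_ \subset _).
Qed.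

Variable p : R.
Hypothesis p01 : 0 <= p <= 1.
Let p_ge0 : 0 <= p. Proof. by case/andP: p01. Qed.
Local Notation Ex := (gnp_Ex (n := n) p).

Lemma gnp_Ex_subset S : S \subset vpairs n ->
  Ex (fun B => (S \subset B)%:R) = p ^+ #|S|.
Proof.
move=> SV; rewrite /gnp_Ex Ex_subset ?enum_uniq//.
rewrite (_ : _ :\: _ = finset.set0) ?finset.sub0set ?mulr1; last first.
  apply/setP => e; rewrite !inE mem_enum; apply/negP => /andP[/negP eV eS].
  by apply: eV; apply: (fintype.subsetP SV).
congr (_ ^+ _); apply: eq_card => e; rewrite !inE mem_enum.
by case: (boolP (e \in S)) => //= /(fintype.subsetP SV).
Qed.

Lemma natr_subsetU S S' B :
  (S \subset B)%:R * (S' \subset B)%:R = (S :|: S' \subset B)%:R :> R.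
Proof. by rewrite finset.subUset -natrM mulnb. Qed.

Lemma card_conditioned_cherry e S w : S \subset [set e] -> w \notin e ->
  e \in vpairs n -> #|S :|: cherry w e| = (#|S| + 2)%N.
Proof.
move=> Se we eV; rewrite cardsU card_cherry// (_ : _ :&: _ = finset.set0) ?cards0 ?subn0//.
apply/setP => c; rewrite !inE; apply/negP => /andP[/(fintype.subsetP Se)].
rewrite inE => /eqP ->; case: (cherry_notin w e) => [/negP//|].
by rewrite (negPf we).
Qed.

(** The set [S], empty or [[set e]], treats at once the plain expectation and the one restricted to
    [e] being an edge. As [e] is in none of its own cherries, the two factors are independent. *)
Lemma Ex_codegree W e S : e \in vpairs n -> S \subset [set e] ->
  Ex (fun B => (S \subset B)%:R * codegree W e B) =
  p ^+ #|S| * (#|W :\: e|%:R * p ^+ 2).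
Proof.
move=> eV Se.
transitivity (Ex (fun B => \sum_(w in W | w \notin e) (S :|: cherry w e \subset B)%:R)).
  apply: eq_Ex => B; rewrite codegreeE mulr_sumr; apply: eq_bigr => w _.
  exact: natr_subsetU.
rewrite /gnp_Ex Ex_sum -/(gnp_Ex _).
rewrite (eq_bigr (fun=> p ^+ #|S| * p ^+ 2)) => [|w /andP[_ we]].
  rewrite sumr_const [RHS]mulrCA [RHS]mulr_natl; congr (_ *+ _).
  by apply: eq_card => w; rewrite !inE andbC.
rewrite -/(gnp_Ex p _) gnp_Ex_subset; first by rewrite card_conditioned_cherry// exprD.
rewrite finset.subUset cherry_vpairs// andbT; apply: (fintype.subset_trans Se).
by rewrite finset.sub1set.
Qed.

(** In the double sum over apices, the diagonal gives [p ^+ 2]; distinct apices have disjoint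
    cherries and give [p ^+ 4]. *)
Lemma Ex_codegree_sqr W e S : e \in vpairs n -> S \subset [set e] ->
  Ex (fun B => (S \subset B)%:R * codegree W e B ^+ 2) <=
  p ^+ #|S| * (#|W :\: e|%:R * p ^+ 2 + #|W :\: e|%:R ^+ 2 * p ^+ 4).
Proof.
move=> eV Se.
have SV : S \subset vpairs n.
  by apply: (fintype.subset_trans Se); rewrite finset.sub1set.
have cardW : #|[pred w in W | w \notin e]| = #|W :\: e|.
  by apply: eq_card => w; rewrite !inE andbC.
have -> : Ex (fun B => (S \subset B)%:R * codegree W e B ^+ 2) =
  \sum_(w in W | w \notin e) \sum_(w' in W | w' \notin e)
    p ^+ #|S :|: cherry w e :|: cherry w' e|.
  transitivity (Ex (fun B => \sum_(w in W | w \notin e) \sum_(w' in W | w' \notin e)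
    (S :|: cherry w e :|: cherry w' e \subset B)%:R)).
    apply: eq_Ex => B; rewrite codegreeE expr2 mulr_suml mulr_sumr.
    apply: eq_bigr => w _; rewrite !mulr_sumr; apply: eq_bigr => w' _.
    by rewrite -!natr_subsetU mulrA.
  rewrite /gnp_Ex Ex_sum; apply: eq_bigr => w /andP[_ we].
  rewrite Ex_sum; apply: eq_bigr => w' /andP[_ w'e].
  by rewrite -/(gnp_Ex p _) gnp_Ex_subset// !finset.subUset SV !cherry_vpairs.
apply: (@le_trans _ _ (\sum_(w in W | w \notin e)
    (p ^+ #|S| * (p ^+ 2 + #|W :\: e|%:R * p ^+ 4)))); last first.
  rewrite sumr_const cardW -[X in X <= _]mulr_natl mulrCA ler_wpM2l ?exprn_ge0//.
  by rewrite mulrDr [X in _ + X]mulrA -[_%:R * _%:R]expr2.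
apply: ler_sum => w /andP[wW we].
rewrite (bigD1 w)/=; last by rewrite wW.
rewrite mulrDr lerD//.
  by rewrite -finset.setUA finset.setUid card_conditioned_cherry// exprD.
apply: (@le_trans _ _ (\sum_(w' in W | w' \notin e) p ^+ #|S| * p ^+ 4)).
  rewrite big_mkcond [leRHS]big_mkcond /=; apply: ler_sum => w' _.
  case: (w' \in W) => //=; case: (boolP (w' \in e)) => //= w'e.
  case: eqP => /= w'w; first by rewrite mulr_ge0 ?exprn_ge0.
  rewrite cardsU card_conditioned_cherry// card_cherry//.
  rewrite (_ : _ :&: _ = finset.set0) ?cards0 ?subn0 -?addnA ?exprD//.
  apply/setP => c; rewrite !inE; apply/negP => /andP[/orP[cS cw'|cw cw']].
    move/(fintype.subsetP Se): cS; rewrite inE => /eqP E; rewrite E in cw'.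
    by case: (cherry_notin w' e) => [/negP//|]; rewrite (negPf w'e).
  have ww' : w != w' by apply/eqP => E; apply: w'w.
  have := cherry_disjoint ww' we; rewrite -setI_eq0 => /eqP/setP/(_ c).
  by rewrite !inE cw cw'.
by rewrite sumr_const cardW -[X in X <= _]mulr_natl mulrCA.
Qed.

Variables (k : nat) (blk : 'I_n -> 'I_k).

Definition block i : {set 'I_n} := [set w | blk w == i].

Lemma sum_codegree_block e B : \sum_i codegree (block i) e B = codegree finset.setT e B.
Proof.
under eq_bigr do rewrite codegreeE.
rewrite codegreeE (partition_big blk predT)//=; apply: eq_bigr => i _.
by apply: eq_bigl => w; rewrite !inE andbC.
Qed.

Variables (psi : R -> R) (psi0 : R).
Hypothesis psi_lip : forall x y, `|psi x - psi y| <= `|x - y|.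
Hypothesis psi_0 : `|psi 0| <= psi0.

(** Two instances matter: [psi = id] with one block counts triangles, and the distance to [Delta]
    gives the defect. Both functions are 1-Lipschitz. *)
Definition codegree_stat B : R :=
  \sum_(e in vpairs n) (e \in B)%:R * \sum_i psi (codegree (block i) e B).

Lemma codegree_self_add f B W : codegree W f (f |: B) = codegree W f B.
Proof.
rewrite !codegreeE; apply: eq_bigr => w /andP[_ wf]; congr ((nat_of_bool _)%:R).
apply/fintype.subsetP/fintype.subsetP => H c cw; have := H c cw; last first.
  by rewrite !inE => ->; rewrite orbT.
rewrite !inE => /orP[/eqP E|//]; rewrite E in cw.
by case: (cherry_notin w f) => [/negP//|]; rewrite (negPf wf).
Qed.

Lemma apicesS W e B S : B \subset S -> apices W e B \subset apices W e S.
Proof.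
move=> BS; apply/fintype.subsetP => w; rewrite !inE => /and3P[-> ->] /=.
by move=> H; apply: fintype.subset_trans BS.
Qed.

Lemma codegreeS W e B S : B \subset S -> codegree W e B <= codegree W e S.
Proof. by move=> BS; rewrite ler_nat subset_leq_card// apicesS. Qed.

(* A pair [e <> f] whose cherries are affected by toggling [f] consists of an
   endpoint of [f] and a common neighbour of the endpoints of [f]. *)
Lemma sum_codegree_toggle f B : f \in vpairs n ->
  \sum_(e in vpairs n | e != f) (e \in B)%:R *
     (codegree finset.setT e (f |: B) - codegree finset.setT e (B :\ f))
  <= 2 * codegree finset.setT f B.
Proof.
move=> fV.
pose X := [set x : {set 'I_n} * 'I_n | [&& x.1 \in vpairs n, x.1 != f, x.1 \in B &
   x.2 \in apices finset.setT x.1 (f |: B) :\: apices finset.setT x.1 (B :\ f)]].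
have inX e w : ((e, w) \in X) = [&& e \in vpairs n, e != f, e \in B &
    w \in apices finset.setT e (f |: B) :\: apices finset.setT e (B :\ f)].
  by rewrite /X inE.
have fB : B :\ f \subset f |: B.
  by apply: (fintype.subset_trans (subD1set _ _)); apply: finset.subsetUr.
have -> : \sum_(e in vpairs n | e != f) (e \in B)%:R *
     (codegree finset.setT e (f |: B) - codegree finset.setT e (B :\ f)) = #|X|%:R.
  transitivity (\sum_(e in vpairs n | e != f) \sum_(w | (e, w) \in X) (1 : R)).
    apply: eq_bigr => e /andP[eV ef].
    rewrite sumr_const; have [eB|eB] := boolP (e \in B); last first.
      rewrite mul0r (_ : #|_| = 0%N)//; apply: eq_card0 => w.
      by rewrite -[LHS]/((e, w) \in X) inX (negPf eB) /= !andbF.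
    rewrite mul1r /codegree -natrB ?subset_leq_card ?apicesS//.
    rewrite -(finset.setIidPr (apicesS finset.setT e fB)) -cardsD; congr (_%:R).
    by apply: eq_card => w; rewrite -[RHS]/((e, w) \in X) inX eV ef eB.
  rewrite pair_big_dep /= sumr_const; congr (_%:R); apply: eq_card => -[e w].
  rewrite -[LHS]/((e \in vpairs n) && (e != f) && ((e, w) \in X)) inX.
  by case: (e \in vpairs n); case: (e != f).
rewrite /codegree -natrM ler_nat.
have f2 : #|f| = 2%N by move: fV; rewrite inE => /eqP.
rewrite -f2 -cardsX.
(* An end [w] of [f] and an apex [v] of [f] determine the pair [(e, w)], where [e] is [f] with [w]
   replaced by [v]. *)
apply: leq_trans (leq_imset_card
  (fun y : 'I_n * 'I_n => (y.2 |: (f :\ y.1), y.1)) _).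
apply: subset_leq_card; apply/fintype.subsetP => -[e w].
rewrite inX /apices !inE /= => /and4P[eV ef eB /andP[nsub /andP[we sub]]].
rewrite we /= in nsub.
have [c cw cB] : exists2 c, c \in cherry w e & c \notin B :\ f.
  by apply/subsetPn.
have cf : c = f.
  move/fintype.subsetP: sub => /(_ c cw); rewrite !inE in cB *.
  by case: eqP => //= cf cB'; move: cB; rewrite cB' andbT; case: eqP.
case/imsetP: cw => u ue cE.
have fE : f = [set u; w] by rewrite -cf.
have [v [vu eE]] : exists v, v != u /\ e = [set u; v].
  have /vpairsP[a [b [ab E]]] : e \in vpairs n by rewrite inE.
  move: ue; rewrite E !inE => /orP[]/eqP ->.
    by exists b; rewrite eq_sym.
  by exists a; rewrite finset.setUC.
have uw : u != w by apply: contraNneq we => <-.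
have vw : v != w by apply: contraNneq we => <-; rewrite eE !inE eqxx orbT.
apply/imsetP; exists (w, v).
  rewrite /apices !inE /= fE !inE eqxx orbT /= negb_or vu vw /=.
  apply/fintype.subsetP => d /imsetP[z]; rewrite !inE => /orP[]/eqP -> ->.
    by rewrite -eE.
  have : [set v; w] \in cherry w e by apply: imset_f; rewrite eE !inE eqxx orbT.
  move/(fintype.subsetP sub); rewrite !inE finset.setUC => /orP[/eqP E|//].
  move/setP: E => /(_ v); rewrite fE !inE eqxx orbT (negPf vu) (negPf vw).
  by [].
congr (_, _); rewrite /= fE eE; apply/setP => z; rewrite !inE.
case: (eqVneq z v) => [->|zv]; first by rewrite orbT.
by case: (eqVneq z w) => [->|]; rewrite ?(negPf zv) ?orbF //= eq_sym (negPf uw).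
Qed.

(** The summand of [f] itself appears or disappears, contributing at most its codegree plus
    [k * psi0]. The other summands change by at most twice that codegree, by the Lipschitz bound and
    [sum_codegree_toggle]. *)
Lemma codegree_stat_toggle f B : f \in vpairs n ->
  `|codegree_stat (f |: B) - codegree_stat (B :\ f)|
   <= 3 * codegree finset.setT f B + k%:R * psi0.
Proof.
move=> fV; rewrite /codegree_stat -sumrB (bigD1 f)//= !inE !eqxx /= mul1r mul0r subr0.
rewrite (_ : 3 * _ + _ = (codegree finset.setT f B + k%:R * psi0) + 2 * codegree finset.setT f B);
  last by ring.
apply: (le_trans (ler_normD _ _)); apply: lerD.
  apply: (le_trans (ler_norm_sum _ _ _)).
  rewrite -sum_codegree_block (_ : k%:R * psi0 = \sum_(i < k) psi0); last first.
    by rewrite sumr_const card_ord mulr_natl.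
  rewrite -big_split; apply: ler_sum => i _ /=; rewrite codegree_self_add.
  set x := codegree _ _ _; have := psi_lip x 0; rewrite subr0 (ger0_norm (_ : 0 <= x))//.
  have := ler_normD (psi x - psi 0) (psi 0); rewrite subrK.
  by have := psi_0; lra.
apply: (le_trans _ (sum_codegree_toggle B fV)).
apply: (le_trans (ler_norm_sum _ _ _)); apply: ler_sum => e /andP[eV ef].
rewrite !inE (negPf ef) /= -mulrBr normrM ger0_norm//.
rewrite ler_wpM2l// -!sum_codegree_block -!sumrB.
apply: (le_trans (ler_norm_sum _ _ _)); apply: ler_sum => i _.
apply: (le_trans (psi_lip _ _)); rewrite ger0_norm// subr_ge0 codegreeS//.
by apply: (fintype.subset_trans (subD1set _ _)); apply: finset.subsetUr.
Qed.

(** Efron-Stein over at most [n ^ 2] pairs, with [(3 * c + D) ^+ 2 <= 18 * c ^+ 2 + 2 * D ^+ 2] and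
    the second moment of the codegree. *)
Lemma codegree_stat_variance :
  Ex (fun B => codegree_stat B ^+ 2) - Ex codegree_stat ^+ 2 <=
  p * n%:R ^+ 2 * (18 * (n%:R * p ^+ 2 + (n%:R * p ^+ 2) ^+ 2) + 2 * (k%:R * psi0) ^+ 2).
Proof.
apply: le_trans (efron_stein p01 codegree_stat finset.set0 (enum_uniq _)) _.
rewrite -mulrA ler_wpM2l// big_enum /=.
set M := 18 * _ + _.
have psi0_ge0 : 0 <= psi0 by apply: le_trans psi_0.
have M0 : 0 <= M.
  by rewrite addr_ge0// mulr_ge0// ?addr_ge0 ?sqr_ge0// mulr_ge0// sqr_ge0.
apply: (@le_trans _ _ (\sum_(f in vpairs n) M)); last first.
  by rewrite sumr_const -[X in X <= _]mulr_natl ler_wpM2r// -natrX ler_nat card_vpairs_le.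
apply: ler_sum => f fV.
apply: (@le_trans _ _ (Ex (fun B => 18 * ((finset.set0 \subset B)%:R
   * codegree finset.setT f B ^+ 2) + 2 * (k%:R * psi0) ^+ 2))).
  apply: (Ex_le p01) => B; rewrite finset.sub0set mul1r -real_normK ?num_real//.
  have H := codegree_stat_toggle B fV.
  set c := codegree _ _ _ in H *; set D := k%:R * psi0 in H *.
  apply: (@le_trans _ _ ((3 * c + D) ^+ 2)).
    by rewrite ler_pXn2r// nnegrE// (le_trans _ H).
  rewrite -subr_ge0 (_ : _ - _ = (3 * c - D) ^+ 2) ?sqr_ge0//; ring.
rewrite /gnp_Ex ExD ExZ Ex_cst lerD2r ler_pM2l// -/(gnp_Ex p _).
apply: le_trans (Ex_codegree_sqr _ fV (finset.sub0set _)) _.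
rewrite cards0 expr0 mul1r exprMn -exprM.
have mn : #|finset.setT :\: f|%:R <= n%:R :> R.
  by rewrite ler_nat -[X in (_ <= X)%N]card_ord max_card.
by rewrite lerD// ler_wpM2r ?exprn_ge0// ler_pXn2r// nnegrE.
Qed.

Definition num_edges B : R := \sum_(e in vpairs n) (e \in B)%:R.

Lemma Ex_num_edges : Ex num_edges = #|vpairs n|%:R * p.
Proof.
rewrite /gnp_Ex Ex_sum (eq_bigr (fun=> p)) => [|e eV]; first by rewrite sumr_const mulr_natl.
rewrite -[RHS]expr1 -[in RHS](cards1 e) -gnp_Ex_subset ?finset.sub1set//.
by apply: eq_Ex => B; rewrite finset.sub1set.
Qed.

Lemma num_edges_variance :
  Ex (fun B => num_edges B ^+ 2) - Ex num_edges ^+ 2 <= p * #|vpairs n|%:R.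
Proof.
apply: le_trans (efron_stein p01 num_edges finset.set0 (enum_uniq _)) _.
rewrite ler_wpM2l// big_enum /= -sum1_card natr_sum; apply: ler_sum => f fV.
rewrite -[leRHS](Ex_cst p (enum (vpairs n)) 1 finset.set0).
apply: (Ex_le p01) => B; rewrite /num_edges -sumrB (bigD1 f)//= !inE !eqxx /=.
rewrite big1 ?addr0 ?subr0 ?expr1n// => e /andP[_ ef].
by rewrite !inE (negPf ef) /= subrr.
Qed.
End Codegrees.

(** * Gallai colourings of a graph *)

Section GallaiGraph.
Variables (R : realType) (n : nat) (G : sgraph n).
Implicit Types (e f g : edge G).

Lemma card_edge : #|{: edge G}| = edge_count G.
Proof. by rewrite card_sig; apply: eq_card => e; rewrite !inE. Qed.

Lemma edge_vpairs e : val e \in vpairs n.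
Proof. by apply: (fintype.subsetP (edges_vpairs G)); case: e. Qed.

Lemma triangleP e f g : reflect (exists x y z, [/\ x != y, y != z, x != z &
    [/\ val e = [set x; y], val f = [set y; z] & val g = [set x; z]]]) (triangle e f g).
Proof.
apply: (iffP existsP) => [[x /existsP[y /existsP[z]]]|[x [y [z [xy yz xz [E1 E2 E3]]]]]].
  rewrite /= !inE negb_or andbT => /and4P[/andP[/andP[xy xz] yz] /eqP E1 /eqP E2 /eqP E3].
  by exists x, y, z.
exists x; apply/existsP; exists y; apply/existsP; exists z.
by rewrite /= !inE negb_or xy yz xz E1 E2 E3 !eqxx.
Qed.

Lemma triangle_rot e f g : triangle e f g = triangle f g e.
Proof.
have rot e' f' g' : triangle e' f' g' -> triangle f' g' e'.
  move=> /triangleP[x [y [z [xy yz xz [E1 E2 E3]]]]]; apply/triangleP.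
  exists y, z, x; split=> //; rewrite 1?eq_sym//.
  by split=> //; rewrite finset.setUC.
by apply/idP/idP => [|/rot/rot]; first exact: rot.
Qed.

Lemma triangle_apices e f g : triangle e f g ->
  exists2 z, z \in apices finset.setT (val e) (edges G) & val f :&: val g = [set z].
Proof.
move=> /triangleP[x [y [z [xy yz xz [E1 E2 E3]]]]]; exists z.
  rewrite /apices !inE /= E1 !inE negb_or ![z == _]eq_sym xz yz /=.
  apply/fintype.subsetP => _ /imsetP[u + ->]; rewrite !inE => /orP[]/eqP ->.
    by rewrite -E3; case: (g).
  by rewrite -E2; case: (f).
rewrite E2 E3; apply/setP => w; rewrite !inE.
by case: (eqVneq w z) => [|_]; rewrite ?orbT// !orbF; case: eqP => // ->; rewrite eq_sym (negPf xy).
Qed.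

Lemma sum_edges (h : {set 'I_n} -> R) :
  \sum_(e in vpairs n) (e \in edges G)%:R * h e = \sum_(e : edge G) h (val e).
Proof.
transitivity (\sum_(e in edges G) h e).
  rewrite big_mkcond [RHS]big_mkcond; apply: eq_bigr => e _.
  case: (boolP (e \in edges G)) => [eG|_]; rewrite ?mul1r ?mul0r ?if_same//.
  by rewrite (fintype.subsetP (edges_vpairs G)).
rewrite (reindex_omap (val : edge G -> _) insub) /= => [|e eG]; last by rewrite insubT.
by apply: eq_bigl => e; rewrite valK eqxx andbT; case: e.
Qed.

Section Blocks.
Variables (k : nat) (blk : 'I_n -> 'I_k.+1).

(** In a triangle, [f] and [g] meet exactly in the apex opposite [e]; the default [ord0] is only for
    disjoint [f] and [g]. *)
Definition apex_block e f g : 'I_k.+1 :=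
  if [pick w in val f :&: val g] is Some w then blk w else ord0.

Definition block_edges i : {set edge G} := [set e : edge G | [exists w, (w \in val e) && (blk w == i)]].

Lemma apex_blockE e f g z : val f :&: val g = [set z] -> apex_block e f g = blk z.
Proof.
rewrite /apex_block => ->; case: pickP => [w|/(_ z)]; rewrite !inE ?eqxx//.
by move=> /eqP ->.
Qed.

Lemma triangle_block_edges e f g :
  triangle e f g -> [set f; g] \subset block_edges (apex_block e f g).
Proof.
move=> /triangle_apices[z _ E]; rewrite (apex_blockE e E).
have : z \in val f :&: val g by rewrite E !inE.
rewrite inE => /andP[zf zg]; rewrite finset.subUset !finset.sub1set !inE.
by apply/andP; split; apply/existsP; exists z; rewrite eqxx andbT.
Qed.

Lemma sum_block_edges : (\sum_i #|block_edges i| <= 2 * #|{: edge G}|)%N.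
Proof.
under eq_bigr do rewrite -sum1_card big_mkcond.
rewrite exchange_big /= mulnC -sum_nat_const; apply: leq_sum => e _.
rewrite -big_mkcond sum1_card.
have <- : #|val e| = 2%N by have := edge_vpairs e; rewrite inE => /eqP.
apply: leq_trans (leq_imset_card blk _); apply: subset_leq_card.
apply/fintype.subsetP => i ie; have : e \in block_edges i by [].
rewrite inE => /existsP[w /andP[we /eqP <-]].
exact: imset_f.
Qed.

(** The factor 2 is the order of the two other edges: [h] sends a boolean for the order and an apex
    to the ordered pair of edges. *)
Lemma block_degreeE e i :
  (block_degree (@triangle n G) apex_block e i)%:R =
  2 * codegree R (block blk i) (val e) (edges G).
Proof.
rewrite /block_degree /codegree -natrM; congr (_%:R).
have /vpairsP[u [v [uv eE]]] := edge_vpairs e.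
pose h (y : bool * 'I_n) := if y.1 then ([set v; y.2], [set u; y.2])
  else ([set u; y.2], [set v; y.2]).
set W := apices _ _ _.
have WP w : w \in W -> [/\ blk w = i, w != u, w != v,
    [set u; w] \in edges G & [set v; w] \in edges G].
  rewrite /W /apices eE !inE negb_or => /and3P[/eqP bw /andP[wu wv] /fintype.subsetP H].
  by split=> //; apply: H; apply: imset_f; rewrite !inE eqxx ?orbT.
have <- : #|finset.setX (finset.setT : {set bool}) W| = (2 * #|W|)%N by rewrite cardsX finset.cardsT card_bool.
have h_inj : {in finset.setX (finset.setT : {set bool}) W &, injective h}.
  have set2r (a c w w' : 'I_n) : w != a -> [set a; w] = [set c; w'] -> w != c -> w = w'.
    move=> wa /setP /(_ w); rewrite !inE eqxx orbT => /esym /orP[/eqP->|/eqP->//].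
    by rewrite eqxx.
  have set2x w w' : w' != u -> w' != v -> [set v; w] <> [set u; w'].
    move=> w'u w'v /setP /(_ v); rewrite !inE eqxx [v == u]eq_sym (negPf uv) /=.
    by move=> /esym/eqP E; rewrite E eqxx in w'v.
  move=> [a w] [c w']; rewrite !finset.in_setX !finset.in_setT /= => /WP[_ wu wv _ _] /WP[_ w'u w'v _ _].
  rewrite /h; case: a; case: c => /= -[E1 E2].
  - by rewrite (set2r _ _ _ _ wv E1 wv).
  - by case: (set2x _ _ w'u w'v E1).
  - by case: (set2x _ _ w'u w'v E2).
  - by rewrite (set2r _ _ _ _ wu E1 wu).
rewrite -(card_in_imset h_inj).
pose val2 (y : edge G * edge G) := (val y.1, val y.2).
have val2_inj : injective val2.
  by move=> [f g] [f' g'] [/val_inj -> /val_inj ->].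
rewrite -(card_imset _ val2_inj); apply: eq_card => y.
apply/imsetP/imsetP => [[[f g]]|[[c w]]].
  rewrite inE /= => /andP[T /eqP bi] ->.
  have [z zW E] := triangle_apices T; rewrite (apex_blockE e E) in bi.
  have zW' : z \in W by move: zW; rewrite /W /apices !inE bi eqxx.
  move/triangleP: T => [x [y' [z' [xy yz xz [E1 E2 E3]]]]].
  have zz : z' = z.
    apply/eqP; have : z' \in val f :&: val g by rewrite E2 E3 !inE eqxx !orbT.
    by rewrite E inE.
  rewrite /val2 /= E2 E3 zz; move: E1; rewrite eE => /setP E1.
  have [/eqP Eu|Eu] := boolP (x == u).
    exists (true, z); first by rewrite finset.in_setX finset.in_setT.
    suff -> : y' = v by rewrite Eu.
    have := E1 v; rewrite !inE eqxx orbT => /esym /orP[/eqP Ev|/eqP//].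
    by rewrite -Eu -Ev eqxx in uv.
  exists (false, z); first by rewrite finset.in_setX finset.in_setT.
  have xv : x = v.
    by have := E1 x; rewrite !inE eqxx (negPf Eu) /= => /eqP.
  suff -> : y' = u by rewrite xv.
  have := E1 u; rewrite !inE eqxx => /esym /orP[/eqP Ev|/eqP//].
  by rewrite -Ev eqxx in Eu.
rewrite finset.in_setX finset.in_setT /= => wW ->; have [bw wu wv uwG vwG] := WP w wW.
have aux (x y' : 'I_n) (xyE : val e = [set x; y']) (xy : x != y') (wx : w != x) (wy : w != y')
    (xwG : [set x; w] \in edges G) (ywG : [set y'; w] \in edges G) :
  exists2 z, z \in [set z : edge G * edge G | triangle e z.1 z.2 && (apex_block e z.1 z.2 == i)]
    & ([set y'; w], [set x; w]) = val2 z.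
  pose f : edge G := exist (fun c => c \in edges G) _ ywG.
  pose g : edge G := exist (fun c => c \in edges G) _ xwG.
  exists (f, g) => //.
  have T : triangle e f g.
    by apply/triangleP; exists x, y', w; split; rewrite // eq_sym.
  rewrite inE /= T /=; have [z _ E] := triangle_apices T; rewrite (apex_blockE e E).
  have : w \in [set z] by rewrite -E /= !inE eqxx !orbT.
  by rewrite inE => /eqP <-; apply/eqP.
case: c; rewrite /h /=; first exact: aux.
by apply: aux => //; [rewrite eE finset.setUC | rewrite eq_sym].
Qed.
End Blocks.

Lemma gallai_colouring_rainbow_free phi e f g :
  phi \in [set phi : {ffun edge G -> 'I_3} | gallai_colouring phi] ->
  triangle e f g -> ~~ uniq [:: phi e; phi f; phi g].
Proof.
rewrite inE => /existsPn /(_ e) /existsPn /(_ f) /existsPn /(_ g).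
by rewrite negb_and => /orP[/negP//|].
Qed.

Lemma Gallai_gt0 : (0 < Gallai G)%N.
Proof.
apply/card_gt0P; exists [ffun=> ord0]; rewrite inE.
apply/existsPn => e; apply/existsPn => f; apply/existsPn => g.
by rewrite !ffunE /= andbF.
Qed.

(** Three times the number of triangles. *)
Definition triangle_edges (B : {set {set 'I_n}}) : R :=
  \sum_(e in vpairs n) (e \in B)%:R * codegree R finset.setT e B.

Lemma Gallai_ge (delta : R) :
  triangle_edges (edges G) <= delta * (edge_count G)%:R ->
  3 `^ ((1 - delta) * (edge_count G)%:R) <= (Gallai G)%:R.
Proof.
move=> H.
(* The edges in no triangle, which are coloured freely while the rest get [ord0]. Every other edge
   has codegree at least 1, so there are at most [triangle_edges] of them. *)
pose E' : {set edge G} := [set e | apices finset.setT (val e) (edges G) == finset.set0].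
have cE' : (1 - delta) * (edge_count G)%:R <= #|E'|%:R.
  suff : (edge_count G)%:R <= #|E'|%:R + triangle_edges (edges G).
    by rewrite mulrBl mul1r; lra.
  rewrite /triangle_edges sum_edges -card_edge -!sum1_card !natr_sum.
  rewrite [X in X + _]big_mkcond -big_split /=; apply: ler_sum => e _.
  rewrite inE /codegree; case: eqP => [_|/eqP ne]; first by rewrite lerDl.
  by rewrite add0r ler1n card_gt0.
apply: (@le_trans _ _ (3 `^ #|E'|%:R)); first by rewrite ler_powR// ler1n.
rewrite powR_mulrn// -natrX ler_nat.
rewrite -[X in (X ^ _)%N](card_ord 3) -(card_pffun_on ord0).
apply: subset_leq_card; apply/fintype.subsetP => phi /pffun_onP[sub _].
rewrite inE; apply/existsPn => e; apply/existsPn => f; apply/existsPn => g.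
rewrite negb_and -implybE; apply/implyP => T.
have phi0 e' f' g' : triangle e' f' g' -> phi e' = ord0.
  move=> /triangle_apices[z zA _]; apply/eqP; apply: contraT => ne.
  have : e' \in E' by apply: (fintype.subsetP sub); rewrite inE.
  by rewrite inE => /eqP A0; rewrite A0 inE in zA.
rewrite (phi0 _ _ _ T); move: T; rewrite triangle_rot => /phi0 ->.
by [].
Qed.
End GallaiGraph.

(** * Concentration *)

Section ResidueBlocks.
Variables (n k : nat).

(** Residue classes give blocks whose sizes differ by at most 1. *)
Definition residue (w : 'I_n) : 'I_k.+1 := inord (w %% k.+1).

Lemma card_residue_block i :
  (n %/ k.+1 <= #|block residue i| <= (n %/ k.+1).+1)%N.
Proof.
have residueE w : (residue w == i) = (w %% k.+1 == i)%N.
  by rewrite -val_eqE /= inordK// ltn_mod.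
apply/andP; split.
  have lt (j : 'I_(n %/ k.+1)) : (j * k.+1 + i < n)%N.
    apply: (@leq_trans (j.+1 * k.+1)); first by rewrite mulSn addnC ltn_add2r.
    by apply: leq_trans (leq_divM n k.+1); rewrite leq_mul2r ltn_ord orbT.
  have inj : injective (fun j => Ordinal (lt j)).
    move=> j j' /(congr1 val) /= /eqP; rewrite eqn_add2r eqn_mul2r /= => /eqP.
    exact: val_inj.
  rewrite -[X in (X <= _)%N]card_ord -(card_imset _ inj).
  apply/subset_leq_card/fintype.subsetP => _ /imsetP[j _ ->].
  by rewrite inE residueE /= modnMDl modn_small.
rewrite -[X in (_ <= X)%N]card_ord.
apply: (@leq_card_in _ _ (fun w : 'I_n => inord (w %/ k.+1) : 'I_(n %/ k.+1).+1)).
move=> w w'; rewrite !inE !residueE => /eqP wi /eqP w'i /(congr1 val) /=.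
rewrite !inordK ?ltnS ?leq_div2r// 1?ltnW// => wq; apply: val_inj => /=.
by rewrite (divn_eq w k.+1) (divn_eq w' k.+1) wq wi w'i.
Qed.

(** Rounding accounts for at most 1 and the ends of [e] for at most 2. *)
Lemma card_residue_blockD (R : realType) i (e : {set 'I_n}) : #|e| = 2%N ->
  `|#|block residue i :\: e|%:R - n%:R / k.+1%:R| <= 3 :> R.
Proof.
move=> e2; have /andP[lb ub] := card_residue_block i.
have K0 : 0 < k.+1%:R :> R by rewrite ltr0n.
have h1 : (#|block residue i :\: e| <= #|block residue i|)%N.
  by rewrite subset_leq_card// finset.subsetDl.
have h2 : (#|block residue i| <= #|block residue i :\: e| + 2)%N.
  have Ib : (#|block residue i :&: e| <= #|block residue i|)%N.
    by rewrite subset_leq_card// finset.subsetIl.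
  rewrite -e2 cardsD -[X in (X <= _)%N](subnK Ib) leq_add2l.
  by rewrite subset_leq_card// finset.subsetIr.
have q1 : (n %/ k.+1)%:R <= n%:R / k.+1%:R :> R.
  by rewrite ler_pdivlMr// -natrM ler_nat leq_divM.
have q2 : n%:R / k.+1%:R <= (n %/ k.+1)%:R + 1 :> R.
  by rewrite ler_pdivrMr// natr1 -natrM ler_nat ltnW// ltn_ceil.
have l1 : (#|block residue i :\: e|)%:R <= (n %/ k.+1)%:R + 1 :> R.
  by rewrite natr1 ler_nat (leq_trans h1).
have l2 : (n %/ k.+1)%:R <= (#|block residue i :\: e|)%:R + 2 :> R.
  by rewrite -natrD ler_nat (leq_trans lb).
move: q1 q2 l1 l2; set a : R := _ / _; set b : R := (_ %/ _)%:R; set c : R := #|_|%:R.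
by move=> q1 q2 l1 l2; rewrite ler_norml; apply/andP; split; lra.
Qed.
End ResidueBlocks.

Section Concentration.
Variables (R : realType) (n : nat) (p : R).
Hypothesis p01 : 0 <= p <= 1.
Let p_ge0 : 0 <= p. Proof. by case/andP: p01. Qed.
Local Notation Ex := (gnp_Ex (n := n) p).
Local Notation X := (n%:R ^+ 2 * p : R).
Local Notation D := (n%:R * p ^+ 2 : R).

Lemma natr_card_vpairs_le : #|vpairs n|%:R <= n%:R ^+ 2 :> R.
Proof. by rewrite -natrX ler_nat card_vpairs_le. Qed.

Lemma card_vpairs_ge : (1 < n)%N -> n%:R ^+ 2 / 4 <= #|vpairs n|%:R :> R.
Proof.
move=> n1; rewrite card_vpairs.
have H : ('C(n, 2) * 2 = n * n.-1)%N.
  by rewrite bin2 muln2 halfK; case: n => //= m; rewrite oddM /= andNb subn0.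
have : n%:R * (n%:R - 1) = 'C(n, 2)%:R * 2 :> R.
  by rewrite -natrM H natrM -subn1 natrB// ltnW.
have : 2 <= n%:R :> R by rewrite ler_nat.
set a : R := n%:R; set b : R := _%:R; nra.
Qed.

Lemma few_edges : (1 < n)%N -> 0 < p ->
  Ex (fun B => (num_edges R B < X / 8)%R%:R) <= 64 / X.
Proof.
move=> n1 p0; have X0 : 0 < X by rewrite mulr_gt0// exprn_gt0// ltr0n ltnW.
have V := natr_card_vpairs_le; have V' := card_vpairs_ge n1.
(* The mean is at least [X / 4], so the deviation is at least [X / 8]. [Ex_chebyshev] concerns the
   upper tail and is applied to the negated count. *)
apply: (@le_trans _ _ (X / (X / 8) ^+ 2)); last first.
  by rewrite le_eqVlt; apply/orP; left; apply/eqP; field; rewrite !gt_eqF// ltr0n ltnW.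
have -> : Ex (fun B => (num_edges R B < X / 8)%R%:R) =
  Ex (fun B => (- (X / 8) < - num_edges R B)%R%:R).
  by apply: eq_Ex => B; rewrite ltrN2.
have EN : Ex (fun B => - num_edges R B) = - Ex (@num_edges R n).
  by rewrite /gnp_Ex -[RHS]mulN1r -ExZ; apply: eq_Ex => B; rewrite mulN1r.
apply: (Ex_chebyshev p01); first by rewrite divr_gt0.
  rewrite -/(gnp_Ex p _) EN Ex_num_edges//.
  have : n%:R ^+ 2 / 4 * p <= #|vpairs n|%:R * p by rewrite ler_wpM2r.
  by lra.
have E2 : Ex (fun B => (- num_edges R B) ^+ 2) = Ex (fun B => num_edges R B ^+ 2).
  by apply: eq_Ex => B; rewrite sqrrN.
rewrite -!/(gnp_Ex p _) EN sqrrN E2.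
by apply: (le_trans (num_edges_variance n p01)); rewrite mulrC ler_wpM2r.
Qed.

Lemma triangle_edgesE :
  @triangle_edges R n = codegree_stat (fun _ : 'I_n => ord0 : 'I_1) id.
Proof.
apply/funext => B; apply: eq_bigr => e _; congr (_ * _).
by rewrite -(sum_codegree_block _ (fun _ : 'I_n => ord0 : 'I_1)).
Qed.

Lemma Ex_triangle_edges : Ex (@triangle_edges R n) <= X * D.
Proof.
rewrite /gnp_Ex Ex_sum.
apply: (@le_trans _ _ (\sum_(e in vpairs n) p * D)).
  apply: ler_sum => e eV.
  apply: (@le_trans _ _ (Ex (fun B => ([set e] \subset B)%:R * codegree R finset.setT e B))).
    by rewrite le_eqVlt; apply/orP; left; apply/eqP; apply: eq_Ex => B; rewrite finset.sub1set.
  rewrite Ex_codegree// cards1 expr1 ler_wpM2l// ler_wpM2r ?exprn_ge0//.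
  by rewrite ler_nat -[X in (_ <= X)%N]card_ord max_card.
rewrite sumr_const -[X in X <= _]mulr_natl mulrA ler_wpM2r ?mulr_ge0 ?exprn_ge0//.
by rewrite ler_wpM2r// natr_card_vpairs_le.
Qed.

Lemma many_triangle_edges (a m : R) : 0 < a -> D <= 1 -> X * D + a <= m ->
  Ex (fun B => (m < triangle_edges R B)%R%:R) <= 36 * X / a ^+ 2.
Proof.
move=> a0 D1 am; have X0 : 0 <= X by rewrite mulr_ge0 ?exprn_ge0.
have D0 : 0 <= D by rewrite mulr_ge0 ?exprn_ge0.
apply: (Ex_chebyshev p01) => //.
  by apply: le_trans am; rewrite lerD2r -/(gnp_Ex p _) Ex_triangle_edges.
rewrite triangle_edgesE.
(* Here [psi0 = 0], and [D <= 1] gives [18 * (D + D ^+ 2) <= 36]. *)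
apply: (le_trans (@codegree_stat_variance _ _ _ p01 _ _ _ 0 _ _)); rewrite ?normr0//.
rewrite mulr0 expr0n mulr0 addr0 [p * _]mulrC.
rewrite [leRHS]mulrC ler_wpM2l//.
have : D ^+ 2 <= D by rewrite expr2 ler_piMl.
by lra.
Qed.

(** Markov's inequality for an integer count, for graphs too sparse for Chebyshev's inequality. *)
Lemma some_triangle_edges :
  Ex (fun B => (0 < triangle_edges R B)%R%:R) <= X * D.
Proof.
apply: le_trans Ex_triangle_edges.
apply: (Ex_le p01) => B; rewrite /triangle_edges.
under eq_bigr do rewrite /codegree -natrM.
by rewrite -natr_sum ltr0n ler_nat; case: (\sum_(_ in _) _)%N.
Qed.

Variables (k : nat) (eps : R).
Hypothesis eps_gt0 : 0 < eps.
Local Notation Delta := (D / k.+1%:R).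
Local Notation defect := (codegree_stat (residue k (n := n)) (fun x : R => `|x - Delta|)).

Hypothesis Delta_ge : 12 + 2 / eps ^+ 2 <= Delta.

(** The absolute deviation is bounded by a quadratic, so two moments suffice. The mean block
    codegree [t] is within 3 of [Delta], so the mean square deviation is at most
    [t + 9 <= Delta + 12]; [Delta_ge] makes this at most [(eps * Delta) ^+ 2]. *)
Lemma Ex_defect : Ex defect <= X * eps * D.
Proof.
have K0 : 0 < k.+1%:R :> R by rewrite ltr0n.
have e2_gt0 : 0 < 2 / eps ^+ 2 by rewrite divr_gt0// exprn_gt0.
have Delta_gt0 : 0 < Delta by apply: lt_le_trans Delta_ge; lra.
rewrite /gnp_Ex Ex_sum.
apply: (@le_trans _ _ (\sum_(e in vpairs n) \sum_(i < k.+1) p * (eps * Delta))); last first.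
  have -> : \sum_(i < k.+1) p * (eps * Delta) = p * (eps * D).
    rewrite sumr_const card_ord -[LHS]mulr_natl; field.
    by rewrite gt_eqF.
  rewrite sumr_const -[X in X <= _]mulr_natl.
  rewrite (_ : X * eps * D = n%:R ^+ 2 * (p * (eps * D))); last by ring.
  rewrite ler_wpM2r ?natr_card_vpairs_le// !mulr_ge0 ?exprn_ge0//.
  exact: ltW.
apply: ler_sum => e eV.
rewrite (eq_Ex _ _ _ (g := fun B => \sum_(i < k.+1) (e \in B)%:R * `|codegree R (block (residue k (n:=n)) i) e B - Delta|)); last first.
  by move=> B; rewrite mulr_sumr.
rewrite Ex_sum; apply: ler_sum => i _.
set W := block _ i; set S := [set e].
have Se : S \subset [set e] by [].
set m : R := #|W :\: e|%:R.
have e2 : #|e| = 2%N by move: eV; rewrite inE => /eqP.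
have mD : `|m * p ^+ 2 - Delta| <= 3.
  rewrite (_ : _ - _ = (m - n%:R / k.+1%:R) * p ^+ 2); last by rewrite mulrBl mulrAC.
  rewrite normrM (ger0_norm (exprn_ge0 2 p_ge0)).
  have : p ^+ 2 <= 1 by rewrite expr_le1//; case/andP: p01.
  have := card_residue_blockD R i e2; rewrite -/W -/m => H1 H2.
  rewrite -[3]mulr1; apply: ler_pM => //; exact: exprn_ge0.
have q (d x : R) : 0 < d -> `|x - d| <= eps / 2 * d + (x - d) ^+ 2 / (2 * eps * d).
  move=> d0; rewrite -[X in _ <= _ + X / _]real_normK ?num_real//; set y := `|_|.
  rewrite -subr_ge0 (_ : _ - _ = (y - eps * d) ^+ 2 / (2 * eps * d)).
    by rewrite divr_ge0 ?sqr_ge0// !mulr_ge0// ltW.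
  by field; rewrite !gt_eqF.
apply: (@le_trans _ _ (Ex (fun B => eps / 2 * Delta * (S \subset B)%:R +
    (2 * eps * Delta)^-1 * ((S \subset B)%:R * codegree R W e B ^+ 2 -
     2 * Delta * ((S \subset B)%:R * codegree R W e B) + Delta ^+ 2 * (S \subset B)%:R)))).
  apply: (Ex_le p01) => B; rewrite finset.sub1set; case: (e \in B) => /=; last first.
    by rewrite !mul0r !mulr0 subr0 !addr0 mulr0.
  rewrite !mul1r !mulr1; apply: (le_trans (q _ _ Delta_gt0)); set c := codegree _ _ _ _.
  by rewrite [_ / (2 * _ * _)]mulrC (_ : (c - Delta) ^+ 2 = c ^+ 2 - 2 * Delta * c + Delta ^+ 2)//; ring.
rewrite /gnp_Ex ExD ExZ ExZ ExD ExB ExZ ExZ -!/(gnp_Ex p _).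
rewrite gnp_Ex_subset ?finset.sub1set// Ex_codegree//.
have H := Ex_codegree_sqr p01 W eV Se.
rewrite cards1 expr1 -/m in H *.
set Y := gnp_Ex _ _ in H *; set t := m * p ^+ 2 in mD H *.
have {}H : Y <= p * (t + t ^+ 2).
  by apply: (le_trans H); rewrite /t exprMn -exprM.
have tD : t + (t - Delta) ^+ 2 <= Delta + 12.
  have h1 : (t - Delta) ^+ 2 <= 9.
    rewrite (_ : 9 = 3 ^+ 2); last by rewrite -natrX.
    by rewrite -[X in X <= _]real_normK ?num_real// ler_pXn2r// nnegrE.
  have h2 : t <= Delta + 3 by move: mD; rewrite ler_norml => /andP[_]; rewrite lerBlDl addrC.
  by rewrite (le_trans (lerD h2 h1))// -addrA -natrD.
have DD : Delta + 12 <= (eps * Delta) ^+ 2.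
  have : eps ^+ 2 * (12 + 2 / eps ^+ 2) <= eps ^+ 2 * Delta.
    by rewrite ler_pM2l ?exprn_gt0.
  rewrite mulrDr [eps ^+ 2 * (2 / _)]mulrC divfK ?gt_eqF ?exprn_gt0// => h.
  have h2 : 2 * Delta <= eps ^+ 2 * Delta * Delta.
    rewrite ler_pM2r//; apply: le_trans h.
    by rewrite lerDr mulr_ge0// exprn_ge0// ltW.
  rewrite (_ : (eps * Delta) ^+ 2 = eps ^+ 2 * Delta * Delta); last by ring.
  have D12 : 12 <= Delta by apply: le_trans Delta_ge; rewrite lerDl ltW.
  by apply: le_trans h2; rewrite (_ : 2 * Delta = Delta + Delta) ?lerD2l//; ring.
have : (2 * eps * Delta)^-1 * (Y - 2 * Delta * (p * t) + Delta ^+ 2 * p) <=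
       p * (eps / 2 * Delta).
  rewrite ler_pdivrMl; last by apply: mulr_gt0 => //; apply: mulr_gt0.
  apply: (@le_trans _ _ (p * (t + (t - Delta) ^+ 2))).
    rewrite -subr_ge0 (_ : _ - _ = p * (t + t ^+ 2) - Y) ?subr_ge0//.
    by set d := Delta; ring.
  rewrite (_ : 2 * eps * Delta * _ = p * (eps * Delta) ^+ 2); last first.
    by set d := Delta; field.
  by rewrite ler_wpM2l// (le_trans tD).
move=> h; rewrite [leRHS](_ : _ = eps / 2 * Delta * p + p * (eps / 2 * Delta)).
  by rewrite lerD2l.
by set d := Delta; field.
Qed.

(** Chebyshev's inequality with [psi0 = Delta], so that [k.+1 * psi0 = D]. As [D >= 1], the variance
    is at most [X * (18 * 2 + 2) * D ^+ 2], whence 38. *)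
Lemma large_defect : 0 < p -> (0 < n)%N ->
  Ex (fun B => (2 * (X * eps * D) < defect B)%R%:R) <= 38 / eps ^+ 2 / X.
Proof.
move=> p0 n0; have n0' : 0 < n%:R :> R by rewrite ltr0n.
have X0 : 0 < X by rewrite mulr_gt0// exprn_gt0.
have D0 : 0 < D by rewrite mulr_gt0// exprn_gt0.
have K0 : 0 < k.+1%:R :> R by rewrite ltr0n.
have e2_gt0 : 0 < 2 / eps ^+ 2 by rewrite divr_gt0// exprn_gt0.
have Delta_ge1 : 1 <= Delta by apply: le_trans Delta_ge; lra.
have D1 : 1 <= D.
  by apply: (le_trans Delta_ge1); rewrite ler_pdivrMr// ler_peMr ?ler1n// ltW.
apply: (@le_trans _ _ (38 * X * D ^+ 2 / (X * eps * D) ^+ 2)); last first.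
  by rewrite le_eqVlt; apply/orP; left; apply/eqP; field; rewrite !gt_eqF.
apply: (Ex_chebyshev p01); first by rewrite !mulr_gt0.
  by rewrite -/(gnp_Ex p _); have := Ex_defect; lra.
have lip (x y : R) : `| `|x - Delta| - `|y - Delta| | <= `|x - y|.
  by apply: (le_trans (ler_dist_dist _ _)); rewrite opprB addrA subrK.
have d0 : `| `|0 - Delta| | <= Delta.
  by rewrite normr_id sub0r normrN ger0_norm//; apply: le_trans Delta_ge1.
apply: (le_trans (codegree_stat_variance p01 _ lip d0)).
have -> : k.+1%:R * Delta = D by rewrite mulrC divfK// gt_eqF.
rewrite [p * _]mulrC [38 * _]mulrC -[leRHS]mulrA ler_pM2l//.
have : D * 1 <= D ^+ 2 by rewrite expr2 ler_pM2l.
by set d : R := D; lra.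
Qed.
End Concentration.

(** * The two thresholds *)

Section UpperBound.
Variable R : realType.

Lemma ln_Gallai_le n (G : sgraph n) k (Delta lambda tau theta : R) :
    0 < Delta -> 0 < lambda -> 0 < tau -> tau <= 3^-1 -> 0 < theta -> theta < 1 ->
  ln (Gallai G)%:R <= (edge_count G)%:R * (ln 3 / lambda - ln (1 - theta)
       + 3 * tau * ln (3 / theta) + ln 2 + 216 * ln 3 * lambda / (tau ^+ 4 * k.+1%:R))
    + (ln 2 + ln 3 + 108 * ln 3 / tau ^+ 4) *
      (codegree_stat (residue k (n := n)) (fun x => `|x - Delta|) (edges G)
        / (k.+1%:R * Delta)).
Proof.
move=> D0 l0 t0 t3 th0 th1.
(* Block degrees are twice the codegrees, so the target degree is [2 * Delta]; the factors 2 cancel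
   in the defect ratio. *)
have D20 : 0 < 2 * Delta by rewrite mulr_gt0.
have := @ln_count_rainbow_free R (edge G) k.+1 _ (Gallai_gt0 G) _ _ _
  (@triangle_rot _ G) (@triangle_block_edges _ G _ (residue k (n := n)))
  (sum_block_edges _ _) (@gallai_colouring_rainbow_free _ G) _ _ l0 D20 isT _ _ t0 t3 th0 th1.
rewrite card_edge; set defect := block_defect _ _ _.
have -> : defect = 2 * codegree_stat (residue k (n := n)) (fun x => `|x - Delta|) (edges G).
  rewrite /defect /block_defect /codegree_stat.
  rewrite (sum_edges _ (fun e => \sum_i `|codegree R (block (residue k (n:=n)) i) e (edges G) - Delta|)).
  rewrite mulr_sumr; apply: eq_bigr => e _; rewrite mulr_sumr; apply: eq_bigr => i _.
  by rewrite block_degreeE -mulrBr normrM ger0_norm.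
set c := codegree_stat _ _ _.
rewrite (_ : 2 * c / (k.+1%:R * (2 * Delta)) = c / (k.+1%:R * Delta))//.
by field; rewrite !gt_eqF.
Qed.

Lemma Gallai_le (delta : R) : 0 < delta -> exists (k : nat) (eps : R), 0 < eps /\
  forall n (G : sgraph n) (Delta : R), 0 < Delta ->
    codegree_stat (residue k (n := n)) (fun x => `|x - Delta|) (edges G)
      <= 16 * eps * (k.+1%:R * Delta) * (edge_count G)%:R ->
  (Gallai G)%:R <= 2 `^ ((1 + delta) * (edge_count G)%:R).
Proof.
move=> delta0.
have ln2 : 0 < ln 2 :> R by rewrite ln_gt0// ltr1n.
have ln3 : 0 < ln 3 :> R by rewrite ln_gt0// ltr1n.
(* Five error terms share [delta * ln 2]. The parameters [lambda], [theta], [tau], [k], [eps] are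
   chosen in this order, each making one term at most [eta]. *)
pose eta : R := delta * ln 2 / 5.
have eta0 : 0 < eta by rewrite divr_gt0// mulr_gt0.
pose lambda := ln 3 / eta.
have lambda0 : 0 < lambda by rewrite divr_gt0.
pose theta := 1 - expR (- eta).
have theta0 : 0 < theta by rewrite subr_gt0 expR_lt1 oppr_lt0.
have theta1 : theta < 1 by rewrite ltrBlDr ltrDl expR_gt0.
have K0 : 0 < ln (3 / theta).
  by rewrite ln_gt0// ltr_pdivlMr// mul1r (lt_trans theta1)// ltr1n.
pose tau := Num.min 3^-1 (eta / (3 * ln (3 / theta))).
have tau0 : 0 < tau by rewrite lt_min invr_gt0 ltr0n/= divr_gt0// mulr_gt0.
have tau3 : tau <= 3^-1 by rewrite ge_min lexx.
have tau_eta : 3 * tau * ln (3 / theta) <= eta.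
  rewrite mulrAC mulrC -ler_pdivlMr ?mulr_gt0//.
  by rewrite ge_min lexx orbT.
have tau4 : 0 < tau ^+ 4 by rewrite exprn_gt0.
pose k := Num.bound (216 * ln 3 * lambda / tau ^+ 4 / eta).
have k_eta : 216 * ln 3 * lambda / (tau ^+ 4 * k.+1%:R) <= eta.
  rewrite invfM mulrA ler_pdivrMr ?ltr0n// -ler_pdivrMl// mulrC.
  have h : 0 <= 216 * ln 3 * lambda / tau ^+ 4 / eta.
    by apply/ltW/divr_gt0 => //; apply: divr_gt0 => //; do 2!apply: mulr_gt0 => //.
  by rewrite (le_trans (ltW (archi_boundP h)))// ler_nat leqnSn.
pose M := ln 2 + ln 3 + 108 * ln 3 / tau ^+ 4.
have M0 : 0 < M by rewrite !addr_gt0// divr_gt0// mulr_gt0.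
pose eps := eta / (16 * M).
have eps0 : 0 < eps by rewrite divr_gt0// mulr_gt0.
exists k, eps; split=> // n G Delta D0 hdef.
have := ln_Gallai_le G k D0 lambda0 tau0 tau3 theta0 theta1.
rewrite -/M (_ : 1 - theta = expR (- eta)); last by rewrite /theta opprB addrCA subrr addr0.
rewrite expRK (_ : ln 3 / lambda = eta); last first.
  by rewrite /lambda invf_div mulrC divfK// gt_eqF.
have defM : M * (codegree_stat (residue k (n := n)) (fun x => `|x - Delta|) (edges G)
        / (k.+1%:R * Delta)) <= eta * (edge_count G)%:R.
  rewrite mulrA ler_pdivrMr ?mulr_gt0// -ler_pdivlMl//.
  apply: (le_trans hdef); rewrite le_eqVlt; apply/orP; left; apply/eqP.
  by rewrite /eps; field; rewrite gt_eqF.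
move=> H.
have {}H : ln (Gallai G)%:R <= (1 + delta) * (edge_count G)%:R * ln 2.
  apply: (le_trans H).
  have -> : (1 + delta) * (edge_count G)%:R * ln 2 =
     (edge_count G)%:R * (eta + eta + eta + ln 2 + eta) + eta * (edge_count G)%:R.
    by rewrite /eta; field.
  apply: lerD => //; rewrite ler_wpM2l// opprK.
  move: tau_eta k_eta; set u := 3 * tau * _; set v := 216 * _ * _ / _; clearbody u v eta.
  by move=> *; lra.
rewrite -ler_ln ?posrE ?ln_powR// ?powR_gt0//.
by rewrite ltr0n Gallai_gt0.
Qed.
End UpperBound.

(** * From tail bounds to statements with high probability *)

Section Whp.
Variable R : realType.

Lemma gnp_weight_ge0 n (p : R) (G : sgraph n) : 0 <= p <= 1 -> 0 <= gnp_weight p G.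
Proof.
by move=> /andP[p0 p1]; apply: prodr_ge0 => e _; case: ifP; rewrite ?subr_ge0.
Qed.

(** Union bound over two bad events. *)
Lemma gnp_prob_ge n (p : R) (A : pred (sgraph n)) (P1 P2 : pred {set {set 'I_n}}) :
    0 <= p <= 1 -> (forall G, ~~ A G -> P1 (edges G) || P2 (edges G)) ->
  1 - (gnp_Ex p (fun B => (P1 B)%:R) + gnp_Ex p (fun B => (P2 B)%:R))
    <= gnp_prob p A <= 1.
Proof.
move=> p01 AP; have w0 G := gnp_weight_ge0 (n := n) G p01.
have := gnp_probT n p; rewrite /gnp_prob (bigID A) /= => E.
apply/andP; split; last by rewrite -E lerDl sumr_ge0.
rewrite -[X in X - _]E -!gnp_probE /gnp_prob lerBlDr lerD2l.
rewrite big_mkcond [X in _ <= X + _]big_mkcond [X in _ <= _ + X]big_mkcond -big_split /=.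
apply: ler_sum => G _; case: ifP => AG; last by rewrite addr_ge0//; case: ifP.
by have := AP G AG; case: (P1 _) => /= [_|->]; rewrite ?add0r ?lerDl//; case: ifP.
Qed.

Local Open Scope classical_set_scope.

Lemma whp_bound (p : nat -> R) (A : forall n, pred (sgraph n)) (M : R) :
  (\forall n \near \oo, 1 - M / Num.sqrt n%:R <= gnp_prob (p n) (A n) <= 1) -> whp p A.
Proof.
move=> H; apply: (squeeze_cvgr H); last exact: cvg_cst.
rewrite -[X in _ --> X]subr0; apply: cvgB; first exact: cvg_cst.
rewrite -(mulr0 M); apply: cvgM; first exact: cvg_cst.
apply/gtr0_cvgV0.
  near=> n; rewrite sqrtr_gt0 ltr0n; near: n; exact: nbhs_infty_gt.
apply/cvgryPge => a; near=> n.
have : a ^+ 2 <= n%:R by near: n; exact: nbhs_infty_ger.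
move=> h; apply: (le_trans (ler_norm a)).
by rewrite -sqrtr_sqr ler_wsqrtr.
Unshelve. all: by end_near. Qed.
End Whp.

Section Main.
Local Open Scope classical_set_scope.

Lemma num_edgesE (R : realType) n (G : sgraph n) :
  num_edges R (edges G) = (edge_count G)%:R.
Proof.
rewrite -card_edge -sum1_card natr_sum -(sum_edges G (fun=> 1)).
by apply: eq_bigr => e _; rewrite mulr1.
Qed.

Lemma powR_n_half (R : realType) n : (n%:R : R) `^ (- 2^-1) = (Num.sqrt n%:R)^-1.
Proof. by rewrite powRN powR12_sqrt. Qed.

(** Two regimes. If [n^2 p <= sqrt n], there is typically no triangle at all, by the first moment.
    Otherwise the numbers of triangles and of edges are both controlled by Chebyshev's inequality,
    with error of order [1 / (n^2 p)]. *)
Lemma Gallai_ge_whp (R : realType) (delta c : R) (p : nat -> R) :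
    0 < delta -> 0 < c -> c ^+ 2 <= 1 -> c ^+ 2 <= delta / 16 ->
    (forall n, 0 <= p n <= 1) ->
    (\forall n \near \oo, p n <= c * n%:R `^ (- 2^-1)) ->
  whp p (fun n G => 3 `^ ((1 - delta) * (edge_count G)%:R) <= (Gallai G)%:R).
Proof.
move=> delta0 c0 c1 cdelta p01 pc.
pose M : R := 1 + 36 * 256 / delta ^+ 2 + 64.
apply: (@whp_bound _ _ _ M); near=> n.
have n1 : (1 < n)%N by near: n; exact: nbhs_infty_gt.
have pcn : p n <= c * n%:R `^ (- 2^-1) by near: n.
have /andP[p0 p1] := p01 n; have p01n := p01 n.
move: pcn; rewrite powR_n_half; set s := Num.sqrt _; move: (p n) p0 p1 p01n => q q0 q1 q01 qc.
have n0 : 0 < n%:R :> R by rewrite ltr0n ltnW.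
have s0 : 0 < s by rewrite sqrtr_gt0.
have s2 : s ^+ 2 = n%:R by rewrite sqr_sqrtr// ltW.
have s1 : 1 <= s.
  by rewrite -[leLHS]sqrtr1 /s ler_wsqrtr// ler1n ltnW.
pose X : R := n%:R ^+ 2 * q; pose D : R := n%:R * q ^+ 2.
have X0 : 0 <= X by rewrite mulr_ge0 ?exprn_ge0.
have D0 : 0 <= D by rewrite mulr_ge0 ?exprn_ge0.
have Dc : D <= c ^+ 2.
  have sq0 : 0 <= s * q by rewrite mulr_ge0// ltW.
  rewrite /D -s2 -exprMn lerXn2r ?nnegrE ?(ltW c0)//.
  by rewrite mulrC -ler_pdivlMr.
have K0 : 0 < delta ^+ 2 by rewrite exprn_gt0.
have M1 : 1 <= M by rewrite /M -addrA lerDl addr_ge0// divr_ge0// ltW.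
have [Xs|Xs] := leP X s.
  (* [X * D = X^3 / n^3], at most [s^3 / s^6]. *)
  have XD : X * D <= s^-1.
    have -> : X * D = X ^+ 3 / n%:R ^+ 3 by rewrite /X /D; field; rewrite gt_eqF.
    rewrite -s2 -exprM ler_pdivrMr ?exprn_gt0//.
    apply: (@le_trans _ _ (s ^+ 3)); first by rewrite lerXn2r ?nnegrE ?(ltW s0).
    have -> : s^-1 * s ^+ (2 * 3) = s ^+ 5 by field; rewrite gt_eqF.
    by rewrite ler_weXn2l.
  have := @gnp_prob_ge R n q (fun G => 3 `^ ((1 - delta) * (edge_count G)%:R) <= (Gallai G)%:R)
    (fun B => 0 < triangle_edges R B) (fun _ => false) q01.
  move=> /(_ _)/andP[|H1 ->].
    move=> G; apply: contraR; rewrite orbF -leNgt => T0; apply: Gallai_ge.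
    by rewrite (le_trans T0)// mulr_ge0// ltW.
  rewrite andbT; apply: le_trans H1; rewrite lerD2l lerN2 /gnp_Ex Ex_cst addr0 -/(gnp_Ex q _).
  apply: (le_trans (some_triangle_edges n q01)); apply: (le_trans XD).
  by rewrite ler_peMl// invr_ge0 ltW.
have Xp : 0 < X by apply: lt_trans Xs.
have q_gt0 : 0 < q by move: Xp; rewrite /X pmulr_rgt0// exprn_gt0.
have := @gnp_prob_ge R n q (fun G => 3 `^ ((1 - delta) * (edge_count G)%:R) <= (Gallai G)%:R)
    (fun B => delta * (X / 8) < triangle_edges R B) (fun B => num_edges R B < X / 8) q01.
move=> /(_ _)/andP[|H1 ->].
  move=> G; apply: contraR; rewrite negb_or -!leNgt num_edgesE => /andP[T0 N0]; apply: Gallai_ge.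
  by apply: (le_trans T0); rewrite ler_pM2l.
rewrite andbT; apply: le_trans H1; rewrite lerD2l lerN2.
have a0 : 0 < delta * X / 16 by rewrite divr_gt0// mulr_gt0.
have B1 : gnp_Ex q (fun B : {set {set 'I_n}} => (delta * (X / 8) < triangle_edges R B)%R%:R)
   <= 36 * 256 / delta ^+ 2 / X.
  apply: (@le_trans _ _ (36 * X / (delta * X / 16) ^+ 2)).
    apply: many_triangle_edges => //; first exact: (le_trans Dc).
    have : X * D <= X * (delta / 16) by rewrite ler_pM2l// (le_trans Dc).
    by rewrite -/X -/D; lra.
  by rewrite le_eqVlt; apply/orP; left; apply/eqP; field; rewrite !gt_eqF.
have B2 := few_edges q01 n1 q_gt0; rewrite -/X in B2.
apply: (le_trans (lerD B1 B2)); rewrite -mulrDl.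
apply: ler_pM => //; first by rewrite addr_ge0// divr_ge0// ltW.
- by rewrite invr_ge0 ltW.
- by rewrite /M -addrA lerDr.
- by rewrite lef_pV2 ?posrE// ltW.
Unshelve. all: by end_near. Qed.

Lemma Gallai_le_whp (R : realType) (delta eps C : R) (k : nat) (p : nat -> R) :
    0 < eps -> 1 <= C -> (12 + 2 / eps ^+ 2) * k.+1%:R <= C ^+ 2 ->
    (forall n (G : sgraph n) (Delta : R), 0 < Delta ->
      codegree_stat (residue k (n := n)) (fun x => `|x - Delta|) (edges G)
        <= 16 * eps * (k.+1%:R * Delta) * (edge_count G)%:R ->
      (Gallai G)%:R <= 2 `^ ((1 + delta) * (edge_count G)%:R)) ->
    (forall n, 0 <= p n <= 1) ->
    (\forall n \near \oo, C * n%:R `^ (- 2^-1) <= p n) ->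
  whp p (fun n G => (Gallai G)%:R <= 2 `^ ((1 + delta) * (edge_count G)%:R)).
Proof.
move=> eps0 C1 CK HG p01 pC.
pose M : R := 38 / eps ^+ 2 + 64.
apply: (@whp_bound _ _ _ M); near=> n.
have n1 : (1 < n)%N by near: n; exact: nbhs_infty_gt.
have pCn : C * n%:R `^ (- 2^-1) <= p n by near: n.
have /andP[p0 p1] := p01 n; have p01n := p01 n.
move: pCn; rewrite powR_n_half; set s := Num.sqrt _; move: (p n) p0 p1 p01n => q q_ge0 q1 q01 qC.
have n0 : 0 < n%:R :> R by rewrite ltr0n ltnW.
have s0 : 0 < s by rewrite sqrtr_gt0.
have s2 : s ^+ 2 = n%:R by rewrite sqr_sqrtr// ltW.
have s1 : 1 <= s.
  by rewrite -[leLHS]sqrtr1 /s ler_wsqrtr// ler1n ltnW.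
pose X : R := n%:R ^+ 2 * q; pose D : R := n%:R * q ^+ 2.
have C0 : 0 < C by apply: lt_le_trans C1.
have q0 : 0 < q by apply: lt_le_trans qC; rewrite mulr_gt0// invr_gt0.
have sq : C <= s * q by rewrite mulrC -ler_pdivrMr.
have CD : C ^+ 2 <= D.
  by rewrite /D -s2 -exprMn lerXn2r ?nnegrE ?(ltW C0) ?(le_trans (ltW C0) sq).
have Kp : 0 < k.+1%:R :> R by rewrite ltr0n.
have DK : 12 + 2 / eps ^+ 2 <= D / k.+1%:R.
  by rewrite ler_pdivlMr// (le_trans CK).
have Dp : 0 < D by rewrite mulr_gt0// exprn_gt0.
(* This makes the Chebyshev errors, of order [1 / X], at most of order [1 / sqrt n]. *)
have Xs : s <= X.
  have -> : X = s ^+ 3 * (s * q) by rewrite /X -s2; ring.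
  apply: (@le_trans _ _ (s ^+ 3 * 1)); first by rewrite mulr1 ler_eXnr.
  by rewrite ler_pM2l ?exprn_gt0// (le_trans C1).
have Xp : 0 < X by apply: lt_le_trans Xs.
pose Z B := codegree_stat (residue k (n := n)) (fun x => `|x - D / k.+1%:R|) B.
have := @gnp_prob_ge R n q (fun G => (Gallai G)%:R <= 2 `^ ((1 + delta) * (edge_count G)%:R))
    (fun B => 2 * (X * eps * D) < Z B) (fun B => num_edges R B < X / 8) q01.
move=> /(_ _)/andP[|H1 ->].
  move=> G; apply: contraR; rewrite negb_or -!leNgt num_edgesE => /andP[T0 N0].
  apply: (HG _ _ (D / k.+1%:R)); first by rewrite divr_gt0.
  rewrite [k.+1%:R * _]mulrC divfK ?gt_eqF//; apply: (le_trans T0).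
  (* The 16 in the hypothesis on the defect absorbs the lower bound [X / 8] on the number of
     edges. *)
  have -> : 2 * (X * eps * D) = 16 * eps * D * (X / 8) by field.
  by rewrite ler_pM2l// !mulr_gt0.
rewrite andbT; apply: le_trans H1; rewrite lerD2l lerN2.
have B1 := large_defect q01 eps0 DK q0 (ltnW n1).
have B2 := few_edges q01 n1 q0.
apply: (le_trans (lerD B1 B2)); rewrite -mulrDl -/X.
rewrite ler_pM2l ?lef_pV2 ?posrE//.
by rewrite addr_gt0// divr_gt0// exprn_gt0.
Unshelve. all: by end_near. Qed.
End Main.

Local Open Scope classical_set_scope.

Theorem theorem1p1 (R : realType) (delta : R) (hdelta : 0 < delta) :
  exists c C : R, [/\ 0 < c, 0 < C &
    forall p : nat -> R, (forall n, 0 <= p n <= 1) ->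
      ((\forall n \near \oo, p n <= c * n%:R `^ (- 2^-1)) ->
        whp p (fun n G =>
          3 `^ ((1 - delta) * (edge_count G)%:R) <= (Gallai G)%:R)) /\
      ((\forall n \near \oo, C * n%:R `^ (- 2^-1) <= p n) ->
        whp p (fun n G =>
          (Gallai G)%:R <= 2 `^ ((1 + delta) * (edge_count G)%:R)))].
Proof.
have [k [eps [eps0 HG]]] := Gallai_le hdelta.
(* The constraints concern [c ^+ 2] and [C ^+ 2]. Since [c <= 1 <= C], squaring only helps, and no
   square root is taken. *)
pose c : R := Num.min 1 (delta / 16).
pose C : R := (12 + 2 / eps ^+ 2) * k.+1%:R.
have c0 : 0 < c by rewrite lt_min ltr01 divr_gt0.
have c1 : c <= 1 by rewrite ge_min lexx.
have cc : c ^+ 2 <= c by rewrite expr2 ler_piMl// ltW.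
have C1 : 1 <= C.
  have e0 : 0 < 2 / eps ^+ 2 by rewrite divr_gt0// exprn_gt0.
  rewrite -[1]mulr1; apply: ler_pM => //; last by rewrite ler1n.
  by lra.
exists c, C; split=> //; first by apply: lt_le_trans C1.
move=> p p01; split=> pn.
  apply: (@Gallai_ge_whp _ _ c) => //; first exact: le_trans cc _.
  by apply: (le_trans cc); rewrite ge_min lexx orbT.
apply: (@Gallai_le_whp _ _ eps C k) => //.
by rewrite -/C expr2 ler_peMl// (le_trans ler01).
Qed.
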